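(* Consider a sequence of finite connected graphs $G$ with $n\to\infty$ vertices and origins $v\in V(G)$, and fix constants $\alpha,\beta>0$. If $\tau_{seq}^v(G)\ge n^{\alpha}$ holds with probability at least $1-n^{-\beta}$, then $\tau_{L\text{-}seq}^v(G)=2(1+o(1))\,\tau_{seq}^v(G)$ with probability $1-o(1)$ (under a suitable coupling of the two processes) and $\mathbb{E}[\tau_{L\text{-}seq}^v(G)]=2(1+o(1))\,\mathbb{E}[\tau_{seq}^v(G)]$. If $\tau_{par}^v(G)\ge n^{\alpha}$ holds with probability at least $1-n^{-\beta}$, then $\tau_{L\text{-}par}^v(G)=2(1+o(1))\,\tau_{par}^v(G)$ with probability $1-o(1)$ (under a suitable coupling) and $\mathbb{E}[\tau_{L\text{-}par}^v(G)]=2(1+o(1))\,\mathbb{E}[\tau_{par}^v(G)]$.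
   Context: Let $G=(V,E)$ be a finite connected graph with $n$ vertices and $v\in V$. Sequential-IDLA from $v$: $n$ particles are released from $v$ one at a time; the first settles at $v$ immediately; each subsequent particle performs a random walk from $v$ until it first arrives at a vertex not occupied by a settled particle, where it settles; only then does the next particle start. Parallel-IDLA from $v$: all $n$ particles start at $v$ at time $0$, one of them settling at $v$ immediately; at each time step every unsettled particle simultaneously takes one random walk step; if one or more particles arrive at an unoccupied vertex, exactly one of them (the one of smallest index) settles there, the others continue. When the walks are simple random walks, $\tau_{seq}^v(G)$ denotes the largest number of steps performed by any particle before settling in Sequential-IDLA and $\tau_{par}^v(G)$ the first time all particles are settled in Parallel-IDLA. $\tau_{L\text{-}seq}^v(G)$ and $\tau_{L\text{-}par}^v(G)$ are the same quantities when the particles instead perform lazy random walks (stay put with probability $1/2$, otherwise move to a uniformly random neighbour). *)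

(* Defs.v *)
From HB Require Import structures.
From mathcomp Require Import all_boot all_order all_algebra.
From mathcomp Require Import all_classical all_reals all_analysis.

Set Implicit Arguments.
Unset Strict Implicit.
Unset Printing Implicit Defensive.

Import Order.TTheory GRing.Theory Num.Theory.
Import numFieldNormedType.Exports.

Local Open Scope classical_set_scope.
Local Open Scope ring_scope.

(* Nonemptiness is not a field: it is provided by the origin of the process. *)
Record cgraph := CGraph {
  vertex :> finType;
  edge : rel vertex;
  edge_sym : symmetric edge;
  edge_irr : irreflexive edge;
  edge_conn : forall x y, connect edge x y }.

Definition degree (G : cgraph) (x : G) : nat := #|[set y | edge x y]%SET|.

(* On the one-vertex graph, where there is no neighbour to jump to, the walk
   stays put. *)
Definition srw (R : realType) (G : cgraph) (x y : G) : R :=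
  if degree x == 0%N then (x == y)%:R else (edge x y)%:R / (degree x)%:R.

Definition lazy_rw (R : realType) (G : cgraph) (x y : G) : R :=
  2^-1 * (x == y)%:R + 2^-1 * srw R x y.

(* [X w i t] is the position after t steps of the walk of particle i. The
   second clause gives all finite-dimensional distributions of the family:
   under P, the walks are mutually independent Markov chains started at v
   with transition matrix K. *)
Definition indep_walks (R : realType) (V : finType) (K : V -> V -> R) (v : V)
    (d : measure_display) (Omega : measurableType d) (P : probability Omega R)
    (X : Omega -> 'I_#|V| -> nat -> V) : Prop :=
  (forall i t x, measurable [set w | X w i t = x]) /\
  (forall (t : nat) (x : 'I_#|V| -> nat -> V),
     P [set w | forall i s, (s <= t)%N -> X w i s = x i s] =
     (\prod_(i < #|V|)
        ((x i 0%N == v)%:R * \prod_(s < t) K (x i s) (x i s.+1)))%:E).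

Definition first_time (p : pred nat) : option nat :=
  if pselect (exists t, p t) is left h then Some (ex_minn h) else None.

(* Sequential-IDLA driven by the walks ws, released in this order, when the
   vertices in A are already occupied: the largest number of steps performed by
   a particle (+oo if some particle never settles). With A empty, the first
   particle settles at its starting point at time 0. *)
Fixpoint seq_idla (R : realType) (V : finType) (A : {set V})
    (ws : seq (nat -> V)) : \bar R :=
  if ws is w :: ws' then
    if first_time (fun t => w t \notin A) is Some t then
      maxe t%:R%:E (seq_idla R (w t |: A) ws')
    else +oo%E
  else 0%E.

Definition tau_seq (R : realType) (V : finType)
    (w : 'I_#|V| -> nat -> V) : \bar R :=
  seq_idla R finset.set0 [seq w i | i <- enum 'I_#|V|].

(* A state of Parallel-IDLA is the pair of the set of settled particles and of
   the set of occupied vertices; [x i] is the current position of particle i,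
   meaningful only for unsettled particles. *)
Definition par_step (V : finType) (n : nat) (x : 'I_n -> V)
    (S : {set 'I_n} * {set V}) : {set 'I_n} * {set V} :=
  let new := [set i : 'I_n | [&& i \notin S.1, x i \notin S.2 &
    [forall j : 'I_n, ((j < i)%N && (j \notin S.1)) ==> (x j != x i)]]]%SET in
  (S.1 :|: new, S.2 :|: [set x i | i in new])%SET.

(* At time 0 all particles are at v, and the settling rule applied to the empty
   configuration settles exactly the particle of smallest index there. *)
Fixpoint par_state (V : finType) (n : nat) (w : 'I_n -> nat -> V) (t : nat) :
    {set 'I_n} * {set V} :=
  par_step (fun i => w i t) (if t is t'.+1 then par_state w t' else (finset.set0, finset.set0)).

Definition tau_par (R : realType) (V : finType)
    (w : 'I_#|V| -> nat -> V) : \bar R :=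
  if first_time (fun t => (par_state w t).1 == [set: 'I_#|V|]%SET) is Some t
  then t%:R%:E else +oo%E.

Definition dispersion_time (R : realType) :=
  forall V : finType, ('I_#|V| -> nat -> V) -> \bar R.

Definition large_whp (R : realType) (tau : dispersion_time R)
    (G : nat -> cgraph) (alpha beta : R)
    (d : nat -> measure_display) (Omega : forall k, measurableType (d k))
    (P : forall k, probability (Omega k) R)
    (X : forall k, Omega k -> 'I_#|G k| -> nat -> G k) : Prop :=
  \forall k \near \oo,
    ((1 - #|G k|%:R `^ (- beta))%:E <=
     P k [set w | (#|G k|%:R `^ alpha)%:E <= tau (G k) (X k w)])%E.

Definition coupled_double (R : realType) (tau : dispersion_time R)
    (G : nat -> cgraph) (v : forall k, G k) : Prop :=
  exists eps delta : R^nat,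
    [/\ eps @ \oo --> (0 : R), delta @ \oo --> (0 : R) &
     forall k, exists (d : measure_display) (Omega : measurableType d)
         (P : probability Omega R) (X Y : Omega -> 'I_#|G k| -> nat -> G k),
       [/\ indep_walks (@srw R (G k)) (v k) P X,
           indep_walks (@lazy_rw R (G k)) (v k) P Y &
           ((1 - delta k)%:E <=
            P [set w | exists2 r : R, (`|r| <= eps k)%R &
                 tau (G k) (Y w) = (2 * (1 + r))%:E * tau (G k) (X w)])%E]].

Definition mean_double (R : realType) (tau : dispersion_time R)
    (G : nat -> cgraph)
    (d : nat -> measure_display) (Omega : forall k, measurableType (d k))
    (P : forall k, probability (Omega k) R)
    (X : forall k, Omega k -> 'I_#|G k| -> nat -> G k)
    (d' : nat -> measure_display) (Omega' : forall k, measurableType (d' k))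
    (P' : forall k, probability (Omega' k) R)
    (Y : forall k, Omega' k -> 'I_#|G k| -> nat -> G k) : Prop :=
  exists2 eps : R^nat, eps @ \oo --> (0 : R) &
    \forall k \near \oo,
      (\int[P' k]_w tau (G k) (Y k w) =
       (2 * (1 + eps k))%:E * \int[P k]_w tau (G k) (X k w))%E.

(* Main.v *)
(* Let a_s and b_u be the tails P(tau > s) and P(tau_L > u) of the dispersion times
   of the simple and of the lazy process. The heart of the proof is
     b_u <= a_s + n P(B <= s)   and   a_s <= b_u + n P(B >= s)
   for B binomial (u, 1/2); the error terms are small unless u is close to 2 s.

   Sequential-IDLA: both inequalities follow by conditioning on the particles one
   after the other, since a lazy walk makes B jumps in u steps.

   Parallel-IDLA: among all policies deciding which particle moves next, each
   particle having a budget of t steps, Parallel-IDLA (always move a particle with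
   the largest remaining budget) minimizes the probability that all particles
   settle. Indeed, if two particles meet on a free vertex, it is worse that the one
   with more budget left is the one that settles. For simple walks, compare with
   the policy in which at each time every particle flips a coin to decide whether it
   moves: this is lazy Parallel-IDLA, up to the event that some particle has fewer
   than s jumps in u steps. For lazy walks, compare with the policy that lets each
   particle step until it really jumps: this is simple Parallel-IDLA, up to the
   event that the u lazy steps of some particle contain s jumps or more.

   Coupling both dispersion times through a common uniform variable turns the two
   inequalities into the almost sure asymptotics, since a union bound over a
   geometric sequence of errors suffices once tau >= n^alpha. Summing the tails over
   blocks gives the expectations, with an additive error of order o(n^alpha). *)

Require Import Defs.
From HB Require Import structures.
From mathcomp Require Import all_boot all_order all_algebra fingroup perm.
From mathcomp Require Import all_classical all_reals all_analysis.
From mathcomp Require Import measurable_realfun ring lra zify.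

Set Implicit Arguments.
Unset Strict Implicit.
Unset Printing Implicit Defensive.

Import Order.TTheory GRing.Theory Num.Theory.
Import numFieldNormedType.Exports.

Local Open Scope classical_set_scope.
Local Open Scope ring_scope.

(** * Scheduled settling and the exchange argument *)

Definition upd (I : eqType) (T : Type) (f : I -> T) (i : I) (y : T) : I -> T :=
  fun j => if j == i then y else f j.

Lemma upd_same (I : eqType) (T : Type) (f : I -> T) i y : upd f i y i = y.
Proof. by rewrite /upd eqxx. Qed.

Lemma upd_diff (I : eqType) (T : Type) (f : I -> T) i j y :
  j != i -> upd f i y j = f j.
Proof. by rewrite /upd => /negbTE->. Qed.

Section Settling.
Variables (V : finType) (n : nat).
Implicit Types (S : {set 'I_n} * {set V}) (i j : 'I_n) (y : V).

Definition settle S i y : {set 'I_n} * {set V} :=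
  if (i \notin S.1) && (y \notin S.2) then (i |: S.1, y |: S.2)%SET else S.

Lemma settle_neq S i j y : j != i -> (j \in (settle S i y).1) = (j \in S.1).
Proof. by rewrite /settle; case: ifP => //= _ /negbTE ji; rewrite !inE ji. Qed.

Lemma settle_eq S i y : i \notin S.1 -> (i \in (settle S i y).1) = (y \notin S.2).
Proof.
by move=> iS; rewrite /settle iS /=; case: ifP => /= yS; rewrite ?inE ?eqxx // (negbTE iS).
Qed.

Lemma settle_occ S i y : y \in S.2 -> settle S i y = S.
Proof. by rewrite /settle => ->; rewrite andbF. Qed.

Lemma settle_settled S i y : i \in S.1 -> settle S i y = S.
Proof. by rewrite /settle => ->. Qed.

Lemma settle2 S i y : i \notin S.1 -> (settle S i y).2 = (y |: S.2)%SET.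
Proof.
rewrite /settle => ->; case: ifPn => //=; rewrite negbK => yS.
by apply/esym/finset.setUidPr; rewrite finset.sub1set.
Qed.

Lemma settle2_sub S i y : S.2 \subset (settle S i y).2.
Proof. by rewrite /settle; case: ifP => //= _; exact: finset.subsetUr. Qed.

Lemma settle1_sub S i y : S.1 \subset (settle S i y).1.
Proof. by rewrite /settle; case: ifP => //= _; exact: finset.subsetUr. Qed.

End Settling.

Section Policies.
Variables (R : realType) (V : finType) (n : nat).
Implicit Types (S : {set 'I_n} * {set V}) (pos : 'I_n -> V) (rem : 'I_n -> nat).
Implicit Types (K : V -> V -> R) (x : R).

(* Probability that all particles are settled after the particles of the list l
   have made one step each, in this order. *)
Fixpoint sched K (l : seq 'I_n) S pos : R :=
  if l is i :: l' then
    \sum_y K (pos i) y * sched K l' (settle S i y) (upd pos i y)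
  else (S.1 == [set: 'I_n]%SET)%:R.

Definition rounds r : seq 'I_n := flatten (nseq r (enum 'I_n)).

(* [policy K S pos rem x]: some adaptive randomized choice of the particle that
   moves next, in which particle i may make at most [rem i] more steps, lets all
   particles settle with probability at most x. *)
Inductive policy K : {set 'I_n} * {set V} -> ('I_n -> V) -> ('I_n -> nat) -> R -> Prop :=
| policy_one S pos rem : policy K S pos rem 1
| policy_fail S pos rem i : i \notin S.1 -> rem i = 0%N -> policy K S pos rem 0
| policy_step S pos rem i (g : V -> R) :
    i \notin S.1 -> (0 < rem i)%N ->
    (forall y, policy K (settle S i y) (upd pos i y) (upd rem i (rem i).-1) (g y)) ->
    policy K S pos rem (\sum_y K (pos i) y * g y)
| policy_mix S pos rem x y : policy K S pos rem x -> policy K S pos rem y ->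
    policy K S pos rem (2^-1 * x + 2^-1 * y)
| policy_le S pos rem x y : policy K S pos rem x -> x <= y -> policy K S pos rem y.

Definition stochastic K := (forall p y, 0 <= K p y) /\ (forall p, \sum_y K p y = 1).

(** The second state is the first one after renaming the particles, with budgets that can only have
    shrunk. The renaming lets two particles trade roles; positions and budgets of settled particles
    are unconstrained. *)
Definition older S pos rem S' pos' rem' := S'.2 = S.2 /\
  exists s : {perm 'I_n}, (forall j, (s j \in S'.1) = (j \in S.1)) /\
   (forall j, j \notin S.1 -> pos' (s j) = pos j /\ (rem' (s j) <= rem j)%N).

Variable K : V -> V -> R.
Hypothesis K1 : stochastic K.

Let K0 : forall p y, 0 <= K p y. Proof. exact: K1.1. Qed.

Lemma policy_ge0 S pos rem x : policy K S pos rem x -> 0 <= x.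
Proof.
elim=> {S pos rem x} //.
- by move=> S pos rem i g _ _ _ IH; apply: sumr_ge0 => y _; rewrite mulr_ge0.
- by move=> S pos rem x y _ hx _ hy; rewrite addr_ge0 ?mulr_ge0 ?invr_ge0.
- by move=> S pos rem x y _ hx; exact: le_trans.
Qed.

Lemma policy_settled S pos rem x :
  policy K S pos rem x -> S.1 = [set: 'I_n]%SET -> 1 <= x.
Proof.
elim=> {S pos rem x} //.
- by move=> S pos rem i iS _ S1; rewrite S1 inE in iS.
- by move=> S pos rem i g iS _ _ _ S1; rewrite S1 inE in iS.
- move=> S pos rem x y _ hx _ hy S1; move: (hx S1) (hy S1); lra.
- by move=> S pos rem x y _ hx xy /hx; move/le_trans; exact.
Qed.

(** Run the renamed policy: with smaller budgets it can only get stuck earlier, and getting stuck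
    counts as value 0. *)
Lemma policy_older S pos rem S' pos' rem' x : policy K S pos rem x ->
  older S pos rem S' pos' rem' -> policy K S' pos' rem' x.
Proof.
move=> h; elim: h S' pos' rem' => {S pos rem x}.
- by move=> *; exact: policy_one.
- move=> S pos rem i iS ri S' pos' rem' [_ [s [sS sp]]].
  apply: (@policy_fail _ _ _ _ (s i)); first by rewrite sS.
  by have [_] := sp _ iS; rewrite ri leqn0 => /eqP.
- move=> S pos rem i g iS ri hg IH S' pos' rem' [S2 [s [sS sp]]].
  have [ep er] := sp _ iS.
  have siS : s i \notin S'.1 by rewrite sS.
  have [r0|r0] := posnP (rem' (s i)).
    apply: policy_le (policy_fail _ _ siS r0) _.
    by apply: sumr_ge0 => y _; rewrite mulr_ge0 // (policy_ge0 (hg y)).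
  rewrite -ep; apply: policy_step => // y; apply: IH; split.
    by rewrite !settle2 // S2.
  exists s; split.
    move=> j; have [->|ji] := eqVneq j i; first by rewrite !settle_eq // S2.
    by rewrite !settle_neq // (inj_eq perm_inj).
  move=> j; have [->|ji] := eqVneq j i.
    by rewrite !upd_same => _; split=> //; rewrite -!subn1 leq_sub2r.
  by rewrite settle_neq // => /sp; rewrite !upd_diff // (inj_eq perm_inj).
- by move=> S pos rem x y _ hx _ hy S' pos' rem' o; apply: policy_mix; [exact: hx|exact: hy].
- by move=> S pos rem x y _ hx xy S' pos' rem' o; apply: policy_le xy; exact: hx.
Qed.

(* If a and i both step onto the same free vertex, the one moved first settles
   there; when a has the larger budget, the outcome in which a settles and i goes
   on is the less favourable one. *)
Lemma older_swap S pos rem a i y z : a != i -> a \notin S.1 -> i \notin S.1 ->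
  (rem i <= rem a)%N ->
  older (settle (settle S i y) a z) (upd (upd pos i y) a z)
    (upd (upd rem i (rem i).-1) a (upd rem i (rem i).-1 a).-1)
    (settle (settle S a z) i y) (upd (upd pos a z) i y)
    (upd (upd rem a (rem a).-1) i (upd rem a (rem a).-1 i).-1).
Proof.
move=> ai aS iS ria; have ia : i != a by rewrite eq_sym.
have aS' u : a \notin (settle S i u).1 by rewrite settle_neq.
have iS' u : i \notin (settle S a u).1 by rewrite settle_neq.
split; first by rewrite !settle2 // finset.setUCA.
rewrite [upd rem i _ a]upd_diff // [upd rem a _ i]upd_diff //.
have [[-> zS]|ne] : (y = z /\ z \notin S.2) \/ ~~ ((y == z) && (z \notin S.2)).
- by have [->|] := eqVneq y z => //=; [case: (boolP (z \in S.2)); [right|left]|right].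
- exists (tperm a i); split=> j.
    case: tpermP => [->|->|/eqP ja /eqP ji].
    + by rewrite !settle_eq // !settle2 // !inE eqxx.
    + by rewrite settle_neq // settle_eq // zS settle_neq // settle_eq // zS.
    + by rewrite !settle_neq.
  case: tpermP => [->|->|/eqP ja /eqP ji].
  + by rewrite !upd_same; split => //; rewrite -!subn1 leq_sub2r.
  + by rewrite settle_neq // settle_eq // zS.
  + by rewrite !upd_diff.
- exists 1%g; split=> j; rewrite perm1.
    have [->|ja] := eqVneq j a.
      rewrite settle_neq // !settle_eq // settle2 // !inE.
      by case: eqVneq ne => [_|_ _] //=; rewrite negbK => ->.
    have [->|ji] := eqVneq j i; last by rewrite !settle_neq.
    rewrite settle_eq // settle2 // !inE settle_neq // settle_eq //.
    by case: eqVneq ne => [e|_ _] //=; rewrite e negbK => ->.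
  move=> _; have [->|ja] := eqVneq j a.
    by rewrite !upd_same !(upd_diff _ _ ai) !upd_same.
  have [->|ji] := eqVneq j i; last by rewrite !upd_diff.
  by rewrite !upd_same !(upd_diff _ _ ia) !upd_same.
Qed.

(** Moving a particle of largest budget first cannot raise the value. If the policy starts with
    another particle [i], induction lets [a] move second, and [older_swap] exchanges the two
    moves. *)
Lemma policy_first S pos rem x a : policy K S pos rem x -> a \notin S.1 ->
  (0 < rem a)%N -> (forall j, j \notin S.1 -> rem j <= rem a)%N ->
  exists2 g : V -> R, \sum_y K (pos a) y * g y <= x &
    forall y, policy K (settle S a y) (upd pos a y) (upd rem a (rem a).-1) (g y).
Proof.
elim=> {S pos rem x}.
- move=> S pos rem aS ra _; exists (fun=> 1); last by move=> y; exact: policy_one.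
  by under eq_bigr do rewrite mulr1; rewrite K1.2.
- move=> S pos rem i iS ri aS ra _; exists (fun=> 0).
    by rewrite big1 // => y _; rewrite mulr0.
  have ia : i != a by apply: contraTneq ra => <-; rewrite ri.
  by move=> y; apply: (@policy_fail _ _ _ _ i); rewrite ?settle_neq ?upd_diff.
- move=> S pos rem i g iS ri hg IH aS ra ha.
  have [ia|ia] := eqVneq i a; first by rewrite -ia; exists g.
  have ai : a != i by rewrite eq_sym.
  have {}IH y : exists g' : V -> R, \sum_z K (pos a) z * g' z <= g y /\
      forall z, policy K (settle (settle S i y) a z) (upd (upd pos i y) a z)
        (upd (upd rem i (rem i).-1) a (upd rem i (rem i).-1 a).-1) (g' z).
    have := IH y; rewrite settle_neq // !(upd_diff _ _ ai) => /(_ aS ra) [|g' hle hpol].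
      move=> j; have [->|ji] := eqVneq j i.
        by rewrite upd_same => _; apply: leq_trans (ha _ iS); exact: leq_pred.
      by rewrite settle_neq // upd_diff //; exact: ha.
    by exists g'; split.
  case: (choice IH) => g2 hg2.
  (* Now [a] moves first, so the value after its move to [z] averages over the move of [i] that
     follows. *)
  exists (fun z => \sum_y K (pos i) y * g2 y z).
    under eq_bigr do rewrite mulr_sumr.
    rewrite exchange_big /=; apply: ler_sum => y _.
    under eq_bigr do rewrite mulrCA.
    by rewrite -mulr_sumr ler_wpM2l //; exact: (hg2 y).1.
  move=> z; have -> : pos i = upd pos a z i by rewrite upd_diff.
  apply: policy_step; rewrite ?settle_neq ?upd_diff // => y.
  have := policy_older ((hg2 y).2 z); apply.
  by have := @older_swap S pos rem a i y z ai aS iS (ha _ iS); rewrite !(upd_diff _ _ ia).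
- move=> S pos rem x y _ hx _ hy aS ra ha.
  have [g1 g1x p1] := hx aS ra ha; have [g2 g2y p2] := hy aS ra ha.
  exists (fun z => 2^-1 * g1 z + 2^-1 * g2 z); last by move=> z; exact: policy_mix.
  under eq_bigr do rewrite mulrDr !(mulrCA _ 2^-1).
  by rewrite big_split -!mulr_sumr lerD // ler_wpM2l // invr_ge0.
- move=> S pos rem x y _ hx xy aS ra ha.
  by have [g gx pg] := hx aS ra ha; exists g => //; exact: le_trans xy.
Qed.

(** Invariant in the middle of a round: the particles of [l] have yet to move in it and own [r + 1]
    steps, the others own [r]. *)
Let sched_le l r := forall S pos rem x, policy K S pos rem x -> uniq l ->
  (forall j, j \notin S.1 -> rem j = r + (j \in l))%N ->
  sched K (l ++ rounds r) S pos <= x.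

(** If unsettled, [i] holds the largest budget and [policy_first] applies; if settled, its move
    changes nothing. *)
Let sched_le_cons i l r : sched_le l r -> sched_le (i :: l) r.
Proof.
move=> IHl S pos rem x hp /andP[il ul] hrem; rewrite cat_cons /=.
have [iS|iS] := boolP (i \in S.1).
  have h y : sched K (l ++ rounds r) (settle S i y) (upd pos i y) <= x.
    apply: (IHl _ _ rem) => //.
      apply: policy_older hp _; rewrite settle_settled //; split=> //.
      exists 1%g; split=> j; rewrite perm1 // => jS; split => //.
      by rewrite upd_diff //; apply: contraNneq jS => ->.
    move=> j; rewrite settle_settled // => jS; rewrite hrem // inE.
    by case: eqVneq => // ji; rewrite ji iS in jS.
  apply: le_trans (ler_sum _ (fun y _ => ler_wpM2l (K0 _ _) (h y))) _.
  by rewrite -mulr_suml K1.2 mul1r.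
have ri : rem i = r.+1 by rewrite hrem // mem_head addn1.
have [||g hg pg] := policy_first hp iS; rewrite ?ri //.
  by move=> j jS; rewrite hrem // -addn1 leq_add2l leq_b1.
apply: le_trans _ hg; apply: ler_sum => y _; rewrite ler_wpM2l //.
apply: IHl (pg y) _ _ => // j; have [->|ji] := eqVneq j i.
  by rewrite upd_same ri (negbTE il) addn0.
by rewrite settle_neq // upd_diff // => /hrem ->; rewrite inE (negbTE ji).
Qed.

(** With equal budgets, round robin always moves a particle of largest remaining budget, hence it is
    a minimizing policy. *)
Lemma sched_rounds_le r S pos rem x : policy K S pos rem x ->
  (forall j, j \notin S.1 -> rem j = r) -> sched K (rounds r) S pos <= x.
Proof.
suff h l : sched_le l r.
  by move=> hp hrem; apply: (h [::]) hp _ _ => // j /hrem ->; rewrite addn0.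
elim: r l {S pos rem x} => [|r IHr]; elim=> [|i l IHl]; try exact: sched_le_cons.
- move=> S pos rem x hp _ _ /=; case: eqP => [S1|_]; last exact: policy_ge0 hp.
  exact: policy_settled hp S1.
(* The round is over; the next one opens with the full list, at the cost of one unit of [r]. *)
- move=> S pos rem x hp _ hrem.
  apply: (IHr (enum 'I_n)) hp _ _; first exact: enum_uniq.
  by move=> j /hrem ->; rewrite mem_enum inE addn0 addn1.
Qed.

End Policies.

(** * Lazy versus non-lazy values *)

Section LazyComparison.
Variables (R : realType) (V : finType).
Implicit Types (K : V -> V -> R) (z : R).

(** For [K] equal to [srw] this unfolds to [lazy_rw], so results on [lazify] apply directly to the
    lazy walks. *)
Definition lazify K p y : R := 2^-1 * (p == y)%:R + 2^-1 * K p y.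

Lemma sum_lazify K p (g : V -> R) :
  \sum_y lazify K p y * g y = 2^-1 * g p + 2^-1 * \sum_y K p y * g y.
Proof.
under eq_bigr do rewrite mulrDl -!mulrA.
rewrite big_split -!mulr_sumr; congr (_ * _ + _).
rewrite (bigD1 p) //= eqxx mul1r big1 ?addr0 // => y.
by rewrite eq_sym => /negbTE ->; rewrite mul0r.
Qed.

Lemma sum_stochasticD K p (f : V -> R) c : stochastic K ->
  \sum_y K p y * (f y + c) = \sum_y K p y * f y + c.
Proof.
by move=> [_ K1]; under eq_bigr do rewrite mulrDr; rewrite big_split -mulr_suml K1 mul1r.
Qed.

Lemma stochastic_lazify K : stochastic K -> stochastic (lazify K).
Proof.
move=> [K0 K1]; split=> [p y|p].
  by rewrite addr_ge0 ?mulr_ge0 ?invr_ge0.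
under eq_bigr do rewrite -[lazify _ _ _]mulr1.
by rewrite sum_lazify; under eq_bigr do rewrite mulr1; rewrite K1 mulr1; lra.
Qed.

(* Markov's inequality for [z ^ B] with B binomial (m, 1/2): this bounds the
   probability of B <= r if z <= 1, and that of B >= r if z >= 1. *)
Definition chernoff z m r : R := z ^- r * ((1 + z) / 2) ^+ m.

Lemma chernoff_ge0 z m r : 0 < z -> 0 <= chernoff z m r.
Proof.
by move=> z0; rewrite mulr_ge0 ?invr_ge0 ?exprn_ge0 ?divr_ge0 ?addr_ge0 // ltW.
Qed.

(** Condition on the first coin: either [r.+1] jumps are still to be made, or [r]. All the
    comparisons by induction rest on this recursion. *)
Lemma chernoffS z m r : 0 < z ->
  chernoff z m.+1 r.+1 = 2^-1 * chernoff z m r.+1 + 2^-1 * chernoff z m r.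
Proof. by move=> z0; rewrite /chernoff !exprS; field; rewrite expf_neq0 gt_eqF. Qed.

(** When the lazy walk has no step left and [z <= 1], the error term alone dominates any
    probability. The next lemma does the same when the simple walk has no jump left and [1 <= z]. *)
Lemma chernoff0l_ge1 z r : 0 < z -> z <= 1 -> 1 <= chernoff z 0 r.
Proof.
move=> z0 z1; rewrite /chernoff expr0 mulr1 invf_ge1 ?exprn_gt0 //.
by rewrite exprn_ile1 // ltW.
Qed.

Lemma chernoff0r_ge1 z m : 1 <= z -> 1 <= chernoff z m 0.
Proof. by move=> z1; rewrite /chernoff expr0 invr1 mul1r exprn_ege1 //; lra. Qed.

(** * Parallel-IDLA: simulating one kind of walk by a policy for the other *)

Section Parallel.
Variable n : nat.
Implicit Types (S : {set 'I_n} * {set V}) (pos : 'I_n -> V) (rem : 'I_n -> nat).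

Lemma sched_ext K l S pos pos' : stochastic K ->
  (forall j, j \notin S.1 -> pos j = pos' j) ->
  sched K l S pos = sched K l S pos'.
Proof.
move=> [K0 K1]; elim: l S pos pos' => //= i l IH S pos pos' pp.
have [iS|iS] := boolP (i \in S.1).
  have h q q' : (forall j, j \notin S.1 -> q j = q' j) ->
    \sum_y K (q i) y * sched K l (settle S i y) (upd q i y) = sched K l S q'.
    move=> qq; under eq_bigr => y _.
      rewrite settle_settled // (IH _ _ q'); first over.
      move=> j jS; rewrite upd_diff ?qq //.
      by apply: contraNneq jS => ->.
    by rewrite -mulr_suml K1 mul1r.
  by rewrite (h pos pos') // (h pos' pos').
rewrite pp //; apply: eq_bigr => y _; congr (_ * _); apply: IH => j.
have [->|ji] := eqVneq j i; first by rewrite !upd_same.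
by rewrite settle_neq // !upd_diff //; exact: pp.
Qed.

Lemma sched_cons_settled K i l S pos : stochastic K -> i \in S.1 ->
  sched K (i :: l) S pos = sched K l S pos.
Proof.
move=> K1 iS /=; under eq_bigr => y _.
  rewrite settle_settled // (@sched_ext _ _ _ _ pos) //; first over.
  by move=> j jS; rewrite upd_diff //; apply: contraNneq jS => ->.
by rewrite -mulr_suml K1.2 mul1r.
Qed.

Lemma sched_ge0 K l S pos : stochastic K -> 0 <= sched K l S pos.
Proof.
move=> [K0 _]; elim: l S pos => //= i l IH S pos.
by apply: sumr_ge0 => y _; rewrite mulr_ge0.
Qed.

Lemma upd_id (I : eqType) (T : Type) (f : I -> T) i : upd f i (f i) = f.
Proof. by apply/funext => j; rewrite /upd; case: eqP => [->|]. Qed.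

(** This invariant makes a lazy step that stays put harmless: the particle cannot settle where it
    stands. *)
Lemma settle_on_occupied S pos i y : (forall j, j \notin S.1 -> pos j \in S.2) ->
  forall j, j \notin (settle S i y).1 -> upd pos i y j \in (settle S i y).2.
Proof.
move=> h j; have [->|ji] := eqVneq j i; last first.
  rewrite settle_neq // upd_diff // => /h; apply: fintype.subsetP; exact: settle2_sub.
rewrite upd_same; have [iS|iS] := boolP (i \in S.1); first by rewrite settle_settled // iS.
by rewrite settle2 // => _; rewrite !inE eqxx.
Qed.

Lemma sum_unsettled_le S i y (F : 'I_n -> R) : (forall j, 0 <= F j) ->
  \sum_(j | j \notin (settle S i y).1) F j <= \sum_(j | j \notin S.1) F j.
Proof.
move=> F0; rewrite big_mkcond [leRHS]big_mkcond; apply: ler_sum => j _.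
case: ifPn => [|_]; last by case: ifP.
by move=> h; rewrite (contra _ h) //; apply: fintype.subsetP; exact: settle1_sub.
Qed.

(** The policy for [K] replays the lazy schedule [l], a coin deciding whether the particle whose
    turn it is moves. A particle out of budget makes the policy fail; if [l] ends first, the
    unsettled particles have jumped too rarely, which the Chernoff terms pay for. *)
Lemma policy_lazy_sched K z l S pos rem : stochastic K -> 0 < z -> z <= 1 ->
  (forall j, j \notin S.1 -> pos j \in S.2) ->
  policy K S pos rem (sched (lazify K) l S pos +
    \sum_(j | j \notin S.1) chernoff z (count_mem j l) (rem j)).
Proof.
move=> K1 z0 z1; have LK1 := stochastic_lazify K1.
have c0 m r := chernoff_ge0 m r z0.
elim: l S pos rem => [|i l IH] S pos rem hS.
  apply: policy_le (policy_one _ _ _ _) _; rewrite /=.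
  case: eqP => [_|/eqP]; first by rewrite lerDl sumr_ge0.
  rewrite -finset.properT => /properP[_ [j _ jS]].
  rewrite (bigD1 j) //= add0r ler_wpDr ?sumr_ge0 //; exact: chernoff0l_ge1.
have [iS|iS] := boolP (i \in S.1).
  rewrite sched_cons_settled //.
  rewrite (eq_bigr (fun j => chernoff z (count_mem j l) (rem j))); first exact: IH.
  by move=> j jS /=; case: eqVneq => // ij; rewrite -ij iS in jS.
case ri : (rem i) => [|r].
  apply: policy_le (policy_fail _ _ iS ri) _.
  by apply: addr_ge0; [exact: sched_ge0|exact: sumr_ge0].
pose E2 := \sum_(j | j \notin S.1) chernoff z (count_mem j l) (upd rem i r j).
have step : policy K S pos rem (\sum_y K (pos i) y *
    (sched (lazify K) l (settle S i y) (upd pos i y) + E2)).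
  apply: policy_step; rewrite ?ri //= => y.
  apply: policy_le (IH _ _ _ _) _; first exact: settle_on_occupied.
  by rewrite lerD2l sum_unsettled_le.
(* The two halves of the lazy kernel are the two sides of the mixture; staying put leaves the state
   unchanged because [pos i] is occupied. *)
apply: policy_le (policy_mix (IH _ _ _ hS) step) _.
rewrite sum_stochasticD //= sum_lazify settle_occ ?hS // upd_id.
rewrite !mulrDr addrACA lerD2l !mulr_sumr -big_split; apply: ler_sum => j jS /=.
have [->|ji] := eqVneq j i.
  by rewrite upd_same add1n ri chernoffS.
by rewrite upd_diff // add0n; lra.
Qed.

(** The lazy policy replays the schedule [l]: the particle whose turn it is repeats lazy steps until
    it leaves its vertex. The zero diagonal of [K] makes a jump recognizable from the position. The
    Chernoff terms pay for particles whose lazy budget outlasts their turns in [l]. *)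
Lemma policy_sched_lazy K z l S pos rem : stochastic K -> (forall p, K p p = 0) ->
  1 <= z -> (forall j, j \notin S.1 -> pos j \in S.2) ->
  policy (lazify K) S pos rem (sched K l S pos +
    \sum_(j | j \notin S.1) chernoff z (rem j) (count_mem j l)).
Proof.
move=> K1 Kd z1; have z0 : 0 < z by exact: lt_le_trans z1.
have c0 m r := chernoff_ge0 m r z0.
elim: l S pos rem => [|i l IH] S pos rem hS.
  apply: policy_le (policy_one _ _ _ _) _; rewrite /=.
  case: eqP => [_|/eqP]; first by rewrite lerDl sumr_ge0.
  rewrite -finset.properT => /properP[_ [j _ jS]].
  rewrite (bigD1 j) //= add0r ler_wpDr ?sumr_ge0 //; exact: chernoff0r_ge1.
have [iS|iS] := boolP (i \in S.1).
  rewrite sched_cons_settled //.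
  rewrite (eq_bigr (fun j => chernoff z (rem j) (count_mem j l))); first exact: IH.
  by move=> j jS /=; case: eqVneq => // ij; rewrite -ij iS in jS.
(* Inner induction on the lazy budget of [i]: an attempt that stays put uses one unit of it and
   leaves the schedule [i :: l] unchanged. *)
move ri : (rem i) => r; elim: r rem ri => [|r IHr] rem ri.
  apply: policy_le (policy_fail _ _ iS ri) _.
  by apply: addr_ge0; [exact: sched_ge0|exact: sumr_ge0].
pose rem' := upd rem i r.
pose E2 := \sum_(j | j \notin S.1) chernoff z (rem' j) (count_mem j l).
pose h y := sched K l (settle S i y) (upd pos i y) + E2.
pose g0 := sched K (i :: l) S pos +
  \sum_(j | j \notin S.1) chernoff z (rem' j) (count_mem j (i :: l)).
have step : policy (lazify K) S pos rem
    (\sum_y lazify K (pos i) y * (if y == pos i then g0 else h y)).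
  apply: policy_step; rewrite ?ri //= => y; case: eqVneq => [->|_].
    by rewrite settle_occ ?hS // upd_id; apply: IHr; rewrite /rem' upd_same.
  apply: policy_le (IH _ _ _ _) _; first exact: settle_on_occupied.
  by rewrite lerD2l sum_unsettled_le.
apply: policy_le step _; rewrite sum_lazify eqxx.
(* The two integrands differ only at [y = pos i], where [K] has weight 0. *)
rewrite (eq_bigr (fun y => K (pos i) y * h y)); last first.
  by move=> y _; case: eqVneq => // ->; rewrite Kd !mul0r.
rewrite /h sum_stochasticD // /g0 /= !mulrDr addrACA -mulrDl.
rewrite (_ : 2^-1 + 2^-1 = 1 :> R); last by lra.
rewrite mul1r lerD2l !mulr_sumr -big_split; apply: ler_sum => j jS /=.
rewrite /rem'; have [->|ji] := eqVneq j i.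
  by rewrite upd_same add1n ri chernoffS.
by rewrite upd_diff // add0n; lra.
Qed.

Lemma count_rounds (j : 'I_n) r : count_mem j (rounds n r) = r.
Proof.
elim: r => //= r IH; rewrite count_cat IH.
by rewrite count_uniq_mem ?enum_uniq // mem_enum inE add1n.
Qed.

Lemma sum_unsettled_const S (c : R) : 0 <= c -> \sum_(j | j \notin S.1) c <= n%:R * c.
Proof.
move=> c0; rewrite big_mkcond.
apply: le_trans (ler_sum (G := fun=> c) _ _) _; first by move=> j _; case: ifP.
by rewrite sumr_const card_ord mulr_natl.
Qed.

(** The coin-flipping policy has budget [s] per particle, so [s] rounds of round robin do at most as
    well. Each of the [n] particles contributes at most one Chernoff term. *)
Lemma sched_le_lazy K z s u S pos : stochastic K -> 0 < z -> z <= 1 ->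
  (forall j, j \notin S.1 -> pos j \in S.2) ->
  sched K (rounds n s) S pos <=
  sched (lazify K) (rounds n u) S pos + n%:R * chernoff z u s.
Proof.
move=> K1 z0 z1 hS.
have := policy_lazy_sched (rounds n u) (fun=> s) K1 z0 z1 hS.
move/(sched_rounds_le K1) => /(_ s) /(_ (fun _ _ => erefl)); move/le_trans; apply.
rewrite lerD2l; under eq_bigr do rewrite count_rounds.
exact: sum_unsettled_const (chernoff_ge0 _ _ z0).
Qed.

Lemma sched_lazy_le K z s u S pos : stochastic K -> (forall p, K p p = 0) -> 1 <= z ->
  (forall j, j \notin S.1 -> pos j \in S.2) ->
  sched (lazify K) (rounds n u) S pos <=
  sched K (rounds n s) S pos + n%:R * chernoff z u s.
Proof.
move=> K1 Kd z1 hS; have z0 : 0 < z by exact: lt_le_trans z1.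
have := policy_sched_lazy (rounds n s) (fun=> u) K1 Kd z1 hS.
move/(sched_rounds_le (stochastic_lazify K1)) => /(_ u) /(_ (fun _ _ => erefl)).
move/le_trans; apply.
rewrite lerD2l; under eq_bigr do rewrite count_rounds.
exact: sum_unsettled_const (chernoff_ge0 _ _ z0).
Qed.

End Parallel.

(** * Sequential-IDLA: comparison one particle after the other *)

Section Sequential.
Implicit Types (A : {set V}) (h : V -> R) (v : V).

(* Expectation of h at the exit point from A of a walk started at p, on the event
   that it exits within r steps. *)
Fixpoint exit_value K h A r p : R :=
  if p \notin A then h p
  else if r is r'.+1 then \sum_y K p y * exit_value K h A r' y else 0.

(* Probability that k particles released one after the other from v, when A is
   occupied, all settle within t steps each. *)
Fixpoint seq_value K v t k A : R :=
  if k is k'.+1 then exit_value K (fun x => seq_value K v t k' (x |: A)%SET) A t v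
  else 1.

Lemma exit_value_bound K h A r p : stochastic K -> (forall x, 0 <= h x <= 1) ->
  0 <= exit_value K h A r p <= 1.
Proof.
move=> [K0 K1] h01; elim: r p => [|r IH] p /=; first by case: ifP => //; rewrite lexx ler01.
case: ifP => // _; apply/andP; split.
  by apply: sumr_ge0 => y _; rewrite mulr_ge0 //; have /andP[] := IH y.
rewrite -(K1 p); apply: ler_sum => y _.
by rewrite ler_piMr //; have /andP[] := IH y.
Qed.

Lemma seq_value_bound K v t k A : stochastic K -> 0 <= seq_value K v t k A <= 1.
Proof.
move=> K1; elim: k A => [|k IH] A /=; first by rewrite ler01 lexx.
exact: exit_value_bound.
Qed.

(** Induction on the lazy budget: a step that stays put consumes only that budget, a jump consumes
    one step of both walks. The term [d] is the error inherited from the particles released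
    later. *)
Lemma exit_value_le_lazy K h1 h2 d z A m r p : stochastic K -> 0 < z -> z <= 1 ->
  0 <= d -> (forall x, 0 <= h1 x <= 1) -> (forall x, 0 <= h2 x <= 1) ->
  (forall x, h1 x <= h2 x + d) ->
  exit_value K h1 A r p <= exit_value (lazify K) h2 A m p + (d + chernoff z m r).
Proof.
move=> K1 z0 z1 d0 h1b h2b h12; have c0 m' r' := chernoff_ge0 m' r' z0.
have LK1 := stochastic_lazify K1.
have out q m' r' : q \notin A ->
    exit_value K h1 A r' q <= exit_value (lazify K) h2 A m' q + (d + chernoff z m' r').
  move=> qA; apply: (@le_trans _ _ (h2 q + d)).
    by case: r' => [|r'] /=; rewrite qA.
  by rewrite addrA; case: m' => [|m'] /=; rewrite qA lerDl.
elim: m r p => [|m IH] r p; have [pA|pA] := boolP (p \notin A); try exact: out.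
  have /andP[_ h] := exit_value_bound A r p K1 h1b.
  apply: (le_trans h); rewrite /= (negbTE pA) add0r ler_wpDl //.
  exact: chernoff0l_ge1.
case: r => [|r].
  rewrite {1}/exit_value (negbTE pA) !addr_ge0 //.
  by have /andP[] := exit_value_bound A m.+1 p LK1 h2b.
rewrite [exit_value (lazify K) _ _ _ _]/= (negbTE pA) sum_lazify chernoffS //.
(* [e1] handles a lazy step that stays put and [e2] a jump; their average is the claim. *)
have e1 := IH r.+1 p.
have e2 : exit_value K h1 A r.+1 p <=
    \sum_y K p y * exit_value (lazify K) h2 A m y + (d + chernoff z m r).
  rewrite /= (negbTE pA) -sum_stochasticD //.
  by apply: ler_sum => y _; rewrite ler_wpM2l //; exact: K1.1.
lra.
Qed.

Lemma exit_value_lazy_le K h1 h2 d z A m r p : stochastic K -> 1 <= z ->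
  0 <= d -> (forall x, 0 <= h1 x <= 1) -> (forall x, 0 <= h2 x <= 1) ->
  (forall x, h1 x <= h2 x + d) ->
  exit_value (lazify K) h1 A m p <= exit_value K h2 A r p + (d + chernoff z m r).
Proof.
move=> K1 z1 d0 h1b h2b h12; have z0 : 0 < z by exact: lt_le_trans z1.
have c0 m' r' := chernoff_ge0 m' r' z0.
have LK1 := stochastic_lazify K1.
have out q m' r' : q \notin A ->
    exit_value (lazify K) h1 A m' q <= exit_value K h2 A r' q + (d + chernoff z m' r').
  move=> qA; apply: (@le_trans _ _ (h2 q + d)).
    by case: m' => [|m'] /=; rewrite qA.
  by rewrite addrA; case: r' => [|r'] /=; rewrite qA lerDl.
elim: m r p => [|m IH] r p; have [pA|pA] := boolP (p \notin A); try exact: out.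
  rewrite /= (negbTE pA) !addr_ge0 //.
  by have /andP[] := exit_value_bound A r p K1 h2b.
case: r => [|r].
  have /andP[_ h] := exit_value_bound A m.+1 p LK1 h1b.
  apply: (le_trans h); rewrite {1}/exit_value (negbTE pA) add0r ler_wpDl //.
  exact: chernoff0r_ge1.
rewrite [exit_value (lazify K) _ _ _ _]/= (negbTE pA) sum_lazify chernoffS //.
have e1 := IH r.+1 p.
have e2 : \sum_y K p y * exit_value (lazify K) h1 A m y <=
    exit_value K h2 A r.+1 p + (d + chernoff z m r).
  rewrite /= (negbTE pA) -sum_stochasticD //.
  by apply: ler_sum => y _; rewrite ler_wpM2l //; exact: K1.1.
lra.
Qed.

Lemma seq_value_le_lazy K v z s u k A : stochastic K -> 0 < z -> z <= 1 ->
  seq_value K v s k A <= seq_value (lazify K) v u k A + k%:R * chernoff z u s.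
Proof.
move=> K1 z0 z1; elim: k A => [|k IH] A /=; first by rewrite mul0r addr0.
have LK1 := stochastic_lazify K1.
rewrite -natr1 mulrDl mul1r; apply: exit_value_le_lazy => // [|x|x].
- by rewrite mulr_ge0 // chernoff_ge0.
- exact: seq_value_bound.
- exact: seq_value_bound.
Qed.

Lemma seq_value_lazy_le K v z s u k A : stochastic K -> 1 <= z ->
  seq_value (lazify K) v u k A <= seq_value K v s k A + k%:R * chernoff z u s.
Proof.
move=> K1 z1; have z0 : 0 < z by exact: lt_le_trans z1.
elim: k A => [|k IH] A /=; first by rewrite mul0r addr0.
have LK1 := stochastic_lazify K1.
rewrite -natr1 mulrDl mul1r; apply: exit_value_lazy_le => // [|x|x].
- by rewrite mulr_ge0 // chernoff_ge0.
- exact: seq_value_bound.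
- exact: seq_value_bound.
Qed.

End Sequential.
End LazyComparison.

(** * Finite-dimensional laws and exploration of the walks *)

Lemma first_timeP (p : pred nat) t :
  first_time p = Some t <-> p t /\ forall s, (s < t)%N -> ~~ p s.
Proof.
rewrite /first_time; case: pselect => [h|h]; last by split=> // -[pt _]; case: h; exists t.
case: ex_minnP => m pm hm; split=> [[<-]|[pt ht]].
  by split=> // s sm; apply: contraL sm => /hm; rewrite -leqNgt.
congr Some; apply/eqP; rewrite eqn_leq hm // leqNgt.
by apply/negP => /ht; rewrite pm.
Qed.

Lemma first_time_exists (p : pred nat) t : p t ->
  exists2 s, (s <= t)%N & first_time p = Some s.
Proof.
move=> pt; rewrite /first_time; case: pselect => [h|[]]; last by exists t.
by case: ex_minnP => m pm hm; exists m => //; exact: hm.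
Qed.

Lemma first_time_None (p : pred nat) t : first_time p = None -> ~~ p t.
Proof. by move=> h; apply/negP => /first_time_exists[s _]; rewrite h. Qed.

Section Exploration.
Variables (R : realType) (V : finType) (K : V -> V -> R) (v : V).
Hypothesis K1 : stochastic K.
Variables (d : measure_display) (Omega : measurableType d) (P : probability Omega R).
Variable X : Omega -> 'I_#|V| -> nat -> V.
Hypothesis hX : indep_walks K v P X.
Local Notation n := #|V|.
Implicit Types (l : 'I_n -> nat) (x : 'I_n -> nat -> V) (E : set Omega).

Lemma measurable_eq_walk i t y : measurable [set w | X w i t = y].
Proof. exact: hX.1. Qed.

Lemma prob_split i t (A : set Omega) : measurable A ->
  P A = (\sum_y P (A `&` [set w | X w i t = y]))%E.
Proof.
move=> mA; rewrite fsbig_seq ?index_enum_uniq // -measure_fin_bigcup //; last 2 first.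
- by move=> y z _ _ [w [[_ <-] [_ <-]]].
- by move=> y _; apply: measurableI => //; exact: measurable_eq_walk.
congr (P _); apply/seteqP; split=> [w Aw|w [y _ []] //].
by exists (X w i t); rewrite /= ?mem_index_enum.
Qed.

(** The explored length [l i] depends on the walk, whereas [indep_walks] observes all walks up to
    one common time: the processes reveal the walks at different speeds. *)
Definition cylinder l x : set Omega :=
  [set w | forall i s, (s <= l i)%N -> X w i s = x i s].

Lemma measurable_cylinder l x : measurable (cylinder l x).
Proof.
have -> : cylinder l x = \bigcap_(i in [set: 'I_n]) \bigcap_(s in [set s | (s <= l i)%N])
    [set w | X w i s = x i s].
  apply/seteqP; split=> w h; first by move=> i _ s si; exact: h.
  by move=> i s si; exact: h.
apply: fin_bigcap_measurable => // i _; apply: bigcap_measurableType => s _.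
exact: measurable_eq_walk.
Qed.

Definition path_weight (p : nat -> V) m : R :=
  (p 0%N == v)%:R * \prod_(s < m) K (p s) (p s.+1).

Lemma path_weight_ext p q m : (forall s, (s <= m)%N -> p s = q s) ->
  path_weight p m = path_weight q m.
Proof.
move=> pq; rewrite /path_weight pq //; congr (_ * _).
by apply: eq_bigr => s _; rewrite !pq // ltnW.
Qed.

Lemma path_weightS p m : path_weight p m.+1 = path_weight p m * K (p m) (p m.+1).
Proof. by rewrite /path_weight big_ord_recr /= mulrA. Qed.

Definition weight l x : R := \prod_(i < n) path_weight (x i) (l i).

Definition step_len l i := upd l i (l i).+1.
Definition step_path l x i y := upd x i (upd (x i) (l i).+1 y).

Lemma step_path_old l x i y j s : (s <= l j)%N -> step_path l x i y j s = x j s.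
Proof.
move=> sl; rewrite /step_path; have [ji|ji] := eqVneq j i; last by rewrite upd_diff.
by rewrite ji upd_same upd_diff // -ji neq_ltn ltnS sl.
Qed.

Lemma step_path_new l x i y : step_path l x i y i (l i).+1 = y.
Proof. by rewrite /step_path !upd_same. Qed.

Lemma cylinder_step l x i y : cylinder (step_len l i) (step_path l x i y) =
  cylinder l x `&` [set w | X w i (l i).+1 = y].
Proof.
apply/seteqP; split=> w.
  move=> h; split.
    move=> j s sl; rewrite h ?step_path_old // /step_len.
    by have [ji|ji] := eqVneq j i; [rewrite ji upd_same -ji leqW|rewrite upd_diff].
  by rewrite /= h ?step_path_new // /step_len upd_same.
move=> [h wy] j s; rewrite /step_len; have [->|ji] := eqVneq j i.
  rewrite upd_same leq_eqVlt => /predU1P[->|]; first by rewrite step_path_new.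
  by move=> sl; rewrite step_path_old //; exact: h.
by rewrite upd_diff // => sl; rewrite step_path_old //; exact: h.
Qed.

Lemma weight_step l x i y :
  weight (step_len l i) (step_path l x i y) = weight l x * K (x i (l i)) y.
Proof.
rewrite /weight (bigD1 i) //= [in RHS](bigD1 i) //=.
rewrite /step_len upd_same path_weightS step_path_new step_path_old //.
rewrite (path_weight_ext (q := x i)); last by move=> s sl; rewrite step_path_old.
rewrite mulrAC; congr (_ * _ * _); apply: eq_bigr => j ji.
by rewrite upd_diff //; apply: path_weight_ext => s sl; rewrite step_path_old.
Qed.

(** Induction on the total length missing before all walks are explored up to a common time [t]:
    lengthening a short walk by one step splits the cylinder, and the transition weights sum to
    1. *)
Lemma prob_cylinder l x : P (cylinder l x) = (weight l x)%:E.
Proof.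
pose t := (\max_i l i)%N.
have : (forall i, l i <= t)%N by move=> i; exact: (leq_bigmax (F := l)).
move: t => t; move kE : (\sum_i (t - l i))%N => k.
elim: k l x kE => [|k IH] l x kE lt.
  have lE i : l i = t.
    apply/eqP; rewrite eqn_leq lt -subn_eq0; apply/eqP.
    by move/eqP: kE; rewrite sum_nat_eq0 => /forallP/(_ i)/implyP/(_ isT)/eqP.
  rewrite /weight (eq_bigr (fun i => (x i 0%N == v)%:R *
    \prod_(s < t) K (x i s) (x i s.+1))) => [|i _]; last by rewrite lE.
  rewrite -hX.2; congr (P _); apply/seteqP; split=> w h i s st; apply: h.
    by rewrite lE.
  by rewrite -(lE i).
have [i li] : exists i, (l i < t)%N.
  apply/existsP; apply: contraPT kE; rewrite negb_exists => /forallP h.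
  rewrite big1 // => i _; apply/eqP; rewrite subn_eq0 leqNgt; exact: h.
rewrite (prob_split i (l i).+1 (measurable_cylinder l x)).
under eq_bigr => y _.
  rewrite -cylinder_step IH; last 2 first.
  - move: kE; rewrite (bigD1 i) //= => kE; rewrite (bigD1 i) //= /step_len upd_same.
    rewrite (eq_bigr (fun j => t - l j)%N) => [|j ji]; last by rewrite upd_diff.
    by move: kE; move: (\sum_(j < n | j != i) _)%N => q; lia.
  - move=> j; rewrite /step_len; have [->|ji] := eqVneq j i; first by rewrite upd_same.
    by rewrite upd_diff.
  rewrite weight_step; over.
by rewrite sumEFin -mulr_sumr K1.2 mulr1.
Qed.

(* [hit_value l x E r]: given the explored piece [cylinder l x] of the walks, the
   event E has conditional probability r. *)
Definition hit_value l x E r := P (cylinder l x `&` E) = (r * weight l x)%:E.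

Lemma hit_value_step i l x E (r : V -> R) : measurable E ->
  (forall y, hit_value (step_len l i) (step_path l x i y) E (r y)) ->
  hit_value l x E (\sum_y K (x i (l i)) y * r y).
Proof.
move=> mE h; rewrite /hit_value (prob_split i (l i).+1); last first.
  by apply: measurableI => //; exact: measurable_cylinder.
under eq_bigr do rewrite setIAC -cylinder_step h weight_step.
rewrite sumEFin mulr_suml; congr EFin; apply: eq_bigr => y _; ring.
Qed.

Lemma hit_value_in l x E : cylinder l x `<=` E -> hit_value l x E 1.
Proof. by move=> /setIidl h; rewrite /hit_value h mul1r prob_cylinder. Qed.

Lemma hit_value_out l x E : cylinder l x `<=` ~` E -> hit_value l x E 0.
Proof. by move/disjoints_subset=> h; rewrite /hit_value h mul0r measure0. Qed.

Lemma hit_value_ext l x E E' r : (forall w, cylinder l x w -> E w <-> E' w) ->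
  hit_value l x E' r -> hit_value l x E r.
Proof.
rewrite /hit_value => h <-; congr (P _); apply/seteqP.
by split=> w [cw Ew]; split=> //; apply/(h w cw).
Qed.

(** All walks start at [v] almost surely, so conditioning on the initial cylinder changes
    nothing. *)
Lemma hit_value_start E r : measurable E ->
  hit_value (fun=> 0%N) (fun _ _ => v) E r -> P E = r%:E.
Proof.
move=> mE; have w1 : weight (fun=> 0%N) (fun _ _ => v) = 1.
  by rewrite /weight big1 // => i _; rewrite /path_weight eqxx big_ord0 mulr1.
rewrite /hit_value w1 mulr1 => <-.
set C := cylinder _ _; have mC : measurable C by exact: measurable_cylinder.
have C0 : P (~` C) = 0%E by rewrite probability_setC // prob_cylinder w1 subee.
rewrite setIC; apply/eqP; rewrite eq_le; apply/andP; split; last first.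
  by apply: le_measure; rewrite ?inE //; exact: measurableI.
have mEC := measurableI _ _ mE mC; have mC' := measurableC mC.
have : (P ((E `&` C) `|` ~` C) <= P (E `&` C) + P (~` C))%E by exact: measureU2.
rewrite C0 adde0; apply: le_trans.
apply: le_measure; rewrite ?inE //; first exact: measurableU.
by move=> w Ew; have [h|h] := pselect (C w); [left|right].
Qed.

(** As [V] is finite there are finitely many trajectories up to time [t], so [E] is a finite union
    of cylinders. *)
Lemma measurable_local t E :
  (forall w w', (forall i s, (s <= t)%N -> X w i s = X w' i s) -> E w -> E w') ->
  measurable E.
Proof.
move=> hE; pose path (f : {ffun 'I_n * 'I_t.+1 -> V}) (i : 'I_n) s : V := f (i, inord s).
have -> : E = \bigcup_(f in [set f | E `&` cylinder (fun=> t) (path f) !=set0])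
    cylinder (fun=> t) (path f).
  apply/seteqP; split=> [w Ew|w' [f [w [Ew cw]] cw']]; last first.
    by apply: hE Ew => i s st; rewrite cw // cw'.
  pose f : {ffun 'I_n * 'I_t.+1 -> V} := [ffun p => X w p.1 (p.2 : 'I_t.+1)].
  have cw : cylinder (fun=> t) (path f) w.
    by move=> i s st; rewrite /path ffunE /= inordK.
  by exists f => //; exists w.
by apply: fin_bigcup_measurable => // f _; exact: measurable_cylinder.
Qed.

End Exploration.

(** * Law of the dispersion time of Sequential-IDLA *)

Section SequentialLaw.
Variables (R : realType) (V : finType).

Lemma seq_idla_leP (A : {set V}) (w : nat -> V) ws t :
  (seq_idla R A (w :: ws) <= t%:R%:E)%E <->
  exists t0, [/\ (t0 <= t)%N, first_time (fun t => w t \notin A) = Some t0 &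
    (seq_idla R (w t0 |: A)%SET ws <= t%:R%:E)%E].
Proof.
rewrite /=; case e: first_time => [t0|]; last by split=> // -[t0 []].
rewrite ge_max lee_fin ler_nat; split=> [/andP[t0t h]|[t1 [t1t [->] ->]]].
  by exists t0.
by rewrite t1t.
Qed.

Lemma first_time_local (p q : pred nat) t0 : (forall s, (s <= t0)%N -> p s = q s) ->
  first_time p = Some t0 -> first_time q = Some t0.
Proof.
move=> pq /first_timeP[pt hp]; apply/first_timeP; split; first by rewrite -pq.
by move=> s st; rewrite -pq ?hp // ltnW.
Qed.

Lemma seq_idla_local (I : Type) (A : {set V}) (f g : I -> nat -> V) (js : seq I) t :
  (forall i s, (s <= t)%N -> f i s = g i s) ->
  (seq_idla R A [seq f i | i <- js] <= t%:R%:E)%E ->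
  (seq_idla R A [seq g i | i <- js] <= t%:R%:E)%E.
Proof.
move=> fg; elim: js A => [//|i js IH] A; rewrite [map _ _]/= [map _ (_ :: _)]/=.
move/seq_idla_leP=> [t0 [t0t h hs]]; apply/seq_idla_leP; exists t0; split=> //.
  by apply: first_time_local h => s st; rewrite fg // (leq_trans st).
by rewrite -fg //; exact: IH.
Qed.

Variables (K : V -> V -> R) (v : V).
Hypothesis K1 : stochastic K.
Variables (d : measure_display) (Omega : measurableType d) (P : probability Omega R).
Variable X : Omega -> 'I_#|V| -> nat -> V.
Hypothesis hX : indep_walks K v P X.

(** The walks are revealed in order of release: an outer induction on the particles, an inner one on
    the steps of the current particle. *)
Lemma hit_value_seq t js A l x : uniq js ->
  (forall j, j \in js -> l j = 0%N /\ x j 0%N = v) ->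
  hit_value K v P X l x
    [set w | (seq_idla R A [seq X w j | j <- js] <= t%:R%:E)%E]
    (seq_value K v t (size js) A).
Proof.
have mE B ks : measurable [set w | (seq_idla R B [seq X w j | j <- ks] <= t%:R%:E)%E].
  by apply: (measurable_local hX (t := t)) => w w' h; exact: seq_idla_local.
elim: js A l x => [|i js IH] A l x.
  by move=> _ _; apply: (hit_value_in K1 hX) => w _ /=; rewrite lee_fin ler0n.
move=> /andP[ijs ujs] hl.
(* Particle [i] has made [s] steps, was inside [A] before time [s], and has [m] steps left. *)
pose claim m s l' x' := (m + s = t)%N -> l' i = s ->
    (forall r, (r < s)%N -> x' i r \in A) ->
    (forall j, j \in js -> l' j = 0%N /\ x' j 0%N = v) ->
    hit_value K v P X l' x'
      [set w | (seq_idla R A [seq X w j | j <- i :: js] <= t%:R%:E)%E]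
      (exit_value K (fun y => seq_value K v t (size js) (y |: A)%SET) A m (x' i s)).
suff h m s l' x' : claim m s l' x'.
  have [li xi] := hl i (mem_head _ _).
  have := h t 0%N l x; rewrite /claim xi; apply=> //; first by rewrite addn0.
  by move=> j jj; apply: hl; rewrite inE jj orbT.
have out m' s' l0 x0 : x0 i s' \notin A -> claim m' s' l0 x0.
  move=> xs ms ls xA hl'.
  have -> h : exit_value K h A m' (x0 i s') = h (x0 i s') by case: m' {ms} => [|m'] /=; rewrite xs.
  apply: hit_value_ext (IH (x0 i s' |: A)%SET _ _ ujs hl') => w cw.
  have ft : first_time (fun t => X w i t \notin A) = Some s'.
    apply/first_timeP; rewrite cw ?ls //; split=> // r rs.
    by rewrite cw ?ls ?(ltnW rs) // negbK xA.
  rewrite -(cw i s') ?ls //=; split=> [/seq_idla_leP[t0 [_]]|h].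
    by rewrite ft => -[<-].
  by apply/seq_idla_leP; exists s'; split=> //; rewrite -ms leq_addl.
elim: m s l' x' => [|m IHm] s l' x'; have [xs|xs] := boolP (x' i s \notin A);
  try exact: out.
(* No step is left and the walk is still in [A]: the event is impossible, matching the value 0. *)
- move=> ms ls xA _.
  rewrite [exit_value _ _ _ _ _]/= (negbTE xs); apply: hit_value_out => w cw /=.
  move/seq_idla_leP => [t0 [t0t /first_timeP[/negP]]]; case.
  have t0s : (t0 <= s)%N by rewrite -[s]add0n ms.
  rewrite cw ?ls //; move: t0s; rewrite leq_eqVlt => /predU1P[->|/xA //].
  by move: xs; rewrite negbK.
- move=> ms ls xA hl'.
  rewrite [exit_value _ _ _ _ _]/= (negbTE xs) -ls; apply: (hit_value_step hX) => // y.
  rewrite -{2}(step_path_new l' x' i y) ls; apply: IHm.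
  + by rewrite addnS -addSn.
  + by rewrite /step_len upd_same ls.
  + move=> r; rewrite ltnS => rs; rewrite step_path_old ?ls //.
    move: rs; rewrite leq_eqVlt => /predU1P[->|/xA //]; by move: xs; rewrite negbK.
  + move=> j jjs; have ji : j != i by apply: contraNneq ijs => <-.
    by rewrite step_path_old // /step_len upd_diff //; exact: hl'.
Qed.

Lemma prob_tau_seq t : P [set w | (tau_seq R (X w) <= t%:R%:E)%E] =
  (seq_value K v t #|V| finset.set0)%:E.
Proof.
have h : hit_value K v P X (fun=> 0%N) (fun _ _ => v)
    [set w | (tau_seq R (X w) <= t%:R%:E)%E] (seq_value K v t #|V| finset.set0).
  have := @hit_value_seq t (enum 'I_#|V|) finset.set0 (fun=> 0%N) (fun _ _ => v).
  by rewrite size_enum_ord; apply=> //; exact: enum_uniq.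
apply: (hit_value_start K1 hX) h.
by apply: (measurable_local hX (t := t)) => w w' h; exact: seq_idla_local.
Qed.

End SequentialLaw.

(** * Law of the dispersion time of Parallel-IDLA *)

Section ParallelStep.
Variables (V : finType) (n : nat).
Implicit Types (S : {set 'I_n} * {set V}).

(** Settling by smallest index amounts to treating the particles one at a time in index order: the
    first unsettled one found on a free vertex takes it. This links the simultaneous rule to
    [sched]. *)
Lemma foldl_settle (x : 'I_n -> V) S :
  foldl (fun S i => settle S i (x i)) S (enum 'I_n) = par_step x S.
Proof.
rewrite /par_step; set new := finset _.
have newE i : (i \in new) = [&& i \notin S.1, x i \notin S.2 &
    [forall j : 'I_n, ((j < i)%N && (j \notin S.1)) ==> (x j != x i)]] by rewrite inE.
clearbody new.
(* The state once the first [m] particles have been treated. *)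
pose T m := (S.1 :|: [set i in new | (i < m)%N],
  S.2 :|: [set x i | i in [set i in new | (i < m)%N]])%SET.
suff h m : (m <= n)%N ->
    foldl (fun S i => settle S i (x i)) S (take m (enum 'I_n)) = T m.
  have := h n (leqnn _); rewrite take_oversize ?size_enum_ord // => ->.
  have -> : new = [set i in new | (i < n)%N]%SET by apply/setP => i; rewrite !inE ltn_ord andbT.
  by [].
elim: m => [_|m IH mn].
  rewrite take0 /= /T; have -> : [set i in new | (i < 0)%N]%SET = finset.set0.
    by apply/setP => i; rewrite !inE andbF.
  by rewrite imset0 !finset.setU0 -surjective_pairing.
pose i := Ordinal mn.
rewrite (take_nth i) ?size_enum_ord // foldl_rcons IH ?(ltnW mn) //.
have -> : nth i (enum 'I_n) m = i by apply/val_inj; rewrite /= nth_enum_ord.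
have [inew|inew] := boolP (i \in new).
  have := inew; rewrite newE => /and3P[iS xS /forallP hi].
  rewrite /settle /T /= !inE (negbTE iS) ltnn andbF (negbTE xS) /=.
  case: imsetP => [[j]|_] /=.
    rewrite !inE newE => /andP[/and3P[jS _ _] jm] xji.
    by have := hi j; rewrite jm jS xji eqxx.
  have -> : [set j in new | (j < m.+1)%N]%SET = (i |: [set j in new | (j < m)%N])%SET.
    apply/setP => j; rewrite !inE ltnS leq_eqVlt.
    by have [->|ji] := eqVneq j i; [rewrite inew /= eqxx|rewrite (inj_eq val_inj j i) (negbTE ji)].
  by congr (_, _); rewrite ?imsetU1 finset.setUCA.
have -> : T m.+1 = T m.
  rewrite /T; suff -> : [set j in new | (j < m.+1)%N]%SET = [set j in new | (j < m)%N]%SET by [].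
  apply/setP => j; rewrite !inE ltnS leq_eqVlt.
  have [->|ji] := eqVneq j i; first by rewrite (negbTE inew).
  by rewrite (inj_eq val_inj j i) (negbTE ji).
have [iS|iS] := boolP (i \in S.1); first by rewrite settle_settled // inE iS.
rewrite settle_occ // inE; have [//|xS] := boolP (x i \in S.2).
have : exists j : 'I_n, [&& (j < m)%N, j \notin S.1 & x j == x i].
  move: inew; rewrite newE iS xS /= negb_forall => /existsP[j].
  by rewrite negb_imply negbK -andbA => h; exists j.
case=> j0 hj0; pose p (j : 'I_n) := [&& (j < m)%N, j \notin S.1 & x j == x i].
(* The smallest unsettled index on the vertex of [i] belongs to [new], so the vertex is already
   taken when [i] is treated. *)
case: (@arg_minnP _ j0 p (fun j : 'I_n => j : nat) hj0) => j /and3P[jm jS /eqP xji] jmin.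
apply/imsetP; exists j => //; rewrite !inE newE jm jS xji xS /= andbT.
apply/forallP => k; apply/implyP => /andP[kj kS]; apply/negP => /eqP xk.
by have := jmin k; rewrite /p kS xk eqxx (ltn_trans kj) //= leqNgt kj => /(_ isT).
Qed.

(** A particle left unsettled by its turn stands on a vertex that is occupied from then on. Applied
    at time 0, this starts the invariant of the comparison lemmas. *)
Lemma par_step_occupied (x : 'I_n -> V) S j :
  j \notin (par_step x S).1 -> x j \in (par_step x S).2.
Proof.
rewrite -foldl_settle; have : j \in enum 'I_n by rewrite mem_enum.
elim/last_ind: (enum 'I_n) => // l i IH; rewrite mem_rcons foldl_rcons inE.
set T := foldl _ _ _ in IH *; have [->|ji /= jl] := eqVneq j i => [_ /= iT|].
  have iT' : i \notin T.1 by apply: contra iT; apply: fintype.subsetP; exact: settle1_sub.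
  by rewrite settle2 // !inE eqxx.
rewrite settle_neq // => /(IH jl); apply: fintype.subsetP; exact: settle2_sub.
Qed.

Lemma par_state_local (w w' : 'I_n -> nat -> V) t :
  (forall i s, (s <= t)%N -> w i s = w' i s) -> par_state w t = par_state w' t.
Proof.
elim: t => [|t IH] h /=.
  by congr par_step; apply/funext => i; exact: h.
rewrite IH => [|i s st]; last by apply: h; rewrite leqW.
by congr par_step; apply/funext => i; exact: h.
Qed.

Lemma par_state_mono (w : 'I_n -> nat -> V) s t :
  (s <= t)%N -> (par_state w s).1 \subset (par_state w t).1.
Proof.
move/subnK <-; elim: (t - s)%N => [|k IH] //; apply: (fintype.subset_trans IH).
exact: finset.subsetUl.
Qed.

End ParallelStep.

Section ParallelLaw.
Variables (R : realType) (V : finType) (K : V -> V -> R) (v : V).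
Hypothesis K1 : stochastic K.
Variables (d : measure_display) (Omega : measurableType d) (P : probability Omega R).
Variable X : Omega -> 'I_#|V| -> nat -> V.
Hypothesis hX : indep_walks K v P X.
Local Notation n := #|V|.
Local Notation all_settled t := [set w | (par_state (X w) t).1 == [set: 'I_n]%SET].

Lemma tau_par_leP (w : 'I_n -> nat -> V) t : (tau_par R w <= t%:R%:E)%E <->
  (par_state w t).1 == [set: 'I_n]%SET.
Proof.
rewrite /tau_par; case e: first_time => [t0|]; last first.
  by split=> //; rewrite (negbTE (first_time_None t e)).
have /first_timeP[/eqP h0 h1] := e; rewrite lee_fin ler_nat; split=> [t0t|ht].
  by rewrite finset.eqEsubset finset.subsetT -h0 par_state_mono.
by rewrite leqNgt; apply/negP => /h1; rewrite ht.
Qed.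

Lemma measurable_all_settled t : measurable (all_settled t).
Proof.
apply: (measurable_local hX (t := t)) => w w' h /=.
by rewrite (@par_state_local _ _ (X w) (X w') t).
Qed.

Lemma hit_value_par t r s l x : (s + r = t)%N -> (forall i, l i = s) ->
  hit_value K v P X l x (all_settled t)
    (sched K (rounds n r) (par_state x s) (fun i => x i s)).
Proof.
elim: r s l x => [|r IH] s l x.
  rewrite addn0 => -> lt /=.
  have st w : cylinder X l x w -> par_state (X w) t = par_state x t.
    by move=> cw; apply: par_state_local => i u ut; apply: cw; rewrite lt.
  have [h|h] := boolP (_ == _).
    by apply: (hit_value_in K1 hX) => w /st /= ->.
  by apply: hit_value_out => w /st /= ->; apply/negP.
move=> sr ls.
(* In the middle of a round, the particles of [l1] have made their step number [s.+1] and those of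
   [l2] have not. *)
suff h l2 l1 l' x' : enum 'I_n = l1 ++ l2 ->
    (forall i, l' i = (s + (i \notin l2))%N) ->
    hit_value K v P X l' x' (all_settled t)
     (sched K (l2 ++ rounds n r)
       (foldl (fun S i => settle S i (x' i s.+1)) (par_state x' s) l1)
       (fun i => x' i (l' i))).
  have := h (enum 'I_n) [::] l x erefl.
  rewrite (_ : (fun i => x i (l i)) = (fun i => x i s)); last by apply/funext => i; rewrite ls.
  by apply=> i; rewrite mem_enum addn0 ls.
elim: l2 l1 l' x' => [|i l2 IH2] l1 l' x' e hl'.
  rewrite cats0 in e; rewrite -e foldl_settle.
  have hl i : l' i = s.+1 by rewrite hl' addn1.
  rewrite (_ : (fun i => x' i (l' i)) = (fun i => x' i s.+1)); last first.
    by apply/funext => i; rewrite hl.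
  by apply: (IH s.+1) => //; rewrite addSnnS.
have li : l' i = s by rewrite hl' mem_head addn0.
have : uniq (enum 'I_n) by exact: enum_uniq.
rewrite e cat_uniq /= => /and4P[_ /norP[il1 /hasPn l12] il2 _].
rewrite /=; apply: (hit_value_step hX); first exact: measurable_all_settled.
move=> y; set x'' := step_path l' x' i y; set l'' := step_len l' i.
have -> : settle (foldl (fun S j => settle S j (x' j s.+1)) (par_state x' s) l1) i y =
    foldl (fun S j => settle S j (x'' j s.+1)) (par_state x'' s) (rcons l1 i).
  have x''i : x'' i s.+1 = y by rewrite -li; exact: step_path_new.
  rewrite foldl_rcons /= x''i; congr (settle _ i y).
  have -> : par_state x'' s = par_state x' s.
    apply: par_state_local => j u us; rewrite /x'' step_path_old // hl'.
    by rewrite (leq_trans us) ?leq_addr.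
  have hx j : j \in l1 -> x'' j s.+1 = x' j s.+1.
    move=> jl; rewrite /x'' step_path_old // hl' inE.
    have ji : j != i by apply: contraNneq il1 => <-.
    by rewrite (negbTE ji) /= (contraTN (l12 j) jl) addn1.
  elim: (l1) hx (par_state x' s) => //= j l1' IHl hx S.
  by rewrite hx ?mem_head // IHl // => k kl; rewrite hx // inE kl orbT.
have -> : upd (fun j => x' j (l' j)) i y = (fun j => x'' j (l'' j)).
  apply/funext => j; rewrite /l'' /step_len; have [->|ji] := eqVneq j i.
    by rewrite !upd_same /x'' step_path_new.
  by rewrite !upd_diff // /x'' step_path_old.
apply: IH2; first by rewrite e cat_rcons.
move=> j; rewrite /l'' /step_len; have [->|ji] := eqVneq j i.
  by rewrite upd_same li il2 addn1.
by rewrite upd_diff // hl' inE (negbTE ji).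
Qed.

Lemma prob_tau_par t : P [set w | (tau_par R (X w) <= t%:R%:E)%E] =
  (sched K (rounds n t) (par_step (fun=> v) (finset.set0, finset.set0)) (fun=> v))%:E.
Proof.
have -> : [set w | (tau_par R (X w) <= t%:R%:E)%E] = all_settled t.
  by apply/seteqP; split=> w /=; [move/tau_par_leP|move=> h; apply/tau_par_leP].
apply: (hit_value_start K1 hX); first exact: measurable_all_settled.
exact: (@hit_value_par t t 0%N).
Qed.

End ParallelLaw.

(** * Tail comparison *)

Section TailComparison.
Variable R : realType.

Lemma stochastic_srw (G : cgraph) : stochastic (@srw R G).
Proof.
split=> [p y|p]; rewrite /srw; first by case: ifP => _; rewrite ?divr_ge0.
have [d0|d0] := boolP (degree p == 0%N).
  by rewrite (bigD1 p) //= eqxx big1 ?addr0 // => y; rewrite eq_sym => /negbTE ->.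
rewrite -mulr_suml -natr_sum (_ : (\sum_y _)%N = degree p) ?divff ?pnatr_eq0 //.
rewrite /degree -sum1_card [RHS]big_mkcond; apply: eq_bigr => y _; rewrite inE.
by case: (edge p y).
Qed.

(** On a connected graph with two vertices or more no degree vanishes, so the convention of staying
    put never applies. *)
Lemma srw_diag (G : cgraph) (p : G) : (1 < #|G|)%N -> srw R p p = 0.
Proof.
move=> G1; rewrite /srw edge_irr mul0r; case: ifPn => // /eqP d0.
have [y yp] : exists y : G, y != p.
  apply/existsP; apply: contraLR G1; rewrite negb_exists -leqNgt => /forallP h.
  apply/card_le1P => y _ w; rewrite !inE.
  by have := h y; have := h w; rewrite !negbK => /eqP-> /eqP->; rewrite eqxx.
have /connectP[[|q s] hs e] := edge_conn p y; first by rewrite e eqxx in yp.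
have : q \in [set z | edge p z]%SET by rewrite inE; case/andP: hs.
by move/eqP: d0; rewrite /degree cards_eq0 => /eqP ->; rewrite inE.
Qed.

(** What the asymptotic part uses of a dispersion time, so that it is carried out once for both
    processes. Two vertices are required in [lc_ge] so that the parallel case can use [srw_diag]. *)
Record lazy_comparable (tau : dispersion_time R) : Prop := LazyComparable {
  lc_nat : forall (V : finType) (w : 'I_#|V| -> nat -> V),
    tau V w = +oo%E \/ exists t : nat, tau V w = t%:R%:E;
  lc_measurable : forall (V : finType) (K : V -> V -> R) (v : V) (d : measure_display)
    (Omega : measurableType d) (P : probability Omega R) X (t : nat),
    indep_walks K v P X -> measurable [set w | (tau V (X w) <= t%:R%:E)%E];
  lc_le : forall (G : cgraph) (v : G) d d' (Omega : measurableType d)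
    (Omega' : measurableType d') (P : probability Omega R) (P' : probability Omega' R)
    X Y (s u : nat) (z : R),
    indep_walks (@srw R G) v P X -> indep_walks (@lazy_rw R G) v P' Y ->
    0 < z -> z <= 1 ->
    (P [set w | tau G (X w) <= s%:R%:E] <=
     P' [set w | tau G (Y w) <= u%:R%:E] + (#|G|%:R * chernoff z u s)%:E)%E;
  lc_ge : forall (G : cgraph) (v : G) d d' (Omega : measurableType d)
    (Omega' : measurableType d') (P : probability Omega R) (P' : probability Omega' R)
    X Y (s u : nat) (z : R), (1 < #|G|)%N ->
    indep_walks (@srw R G) v P X -> indep_walks (@lazy_rw R G) v P' Y -> 1 <= z ->
    (P' [set w | tau G (Y w) <= u%:R%:E] <=
     P [set w | tau G (X w) <= s%:R%:E] + (#|G|%:R * chernoff z u s)%:E)%E }.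

Lemma lazy_comparable_seq : lazy_comparable (@tau_seq R).
Proof.
split=> [V w|V K v d Omega P X t hX|G v d d' Om Om' P P' X Y s u z hX hY z0 z1|
  G v d d' Om Om' P P' X Y s u z G1 hX hY z1].
- rewrite /tau_seq; elim: (enum _) finset.set0 => [|i js IH] A /=; first by right; exists 0%N.
  case: first_time => [t|]; last by left.
  by have [->|[u ->]] := IH (w i t |: A)%SET;
    [left; rewrite maxey|right; exists (maxn t u); rewrite -EFin_max natr_max].
- by apply: (measurable_local hX (t := t)) => w w' h; exact: seq_idla_local.
- have K1 := stochastic_srw G.
  rewrite (prob_tau_seq K1 hX) (prob_tau_seq (stochastic_lazify K1) hY) -EFinD lee_fin.
  exact: seq_value_le_lazy.
- have K1 := stochastic_srw G.
  rewrite (prob_tau_seq K1 hX) (prob_tau_seq (stochastic_lazify K1) hY) -EFinD lee_fin.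
  exact: seq_value_lazy_le.
Qed.

Lemma lazy_comparable_par : lazy_comparable (@tau_par R).
Proof.
split=> [V w|V K v d Omega P X t hX|G v d d' Om Om' P P' X Y s u z hX hY z0 z1|
  G v d d' Om Om' P P' X Y s u z G1 hX hY z1].
- by rewrite /tau_par; case: first_time => [t|]; [right; exists t|left].
- have -> : [set w | (tau_par R (X w) <= t%:R%:E)%E] =
    [set w | (par_state (X w) t).1 == [set: 'I_#|V|]%SET].
    by apply/seteqP; split=> w /=; [move/tau_par_leP|move=> h; apply/tau_par_leP].
  exact: measurable_all_settled hX t.
- have K1 := stochastic_srw G.
  rewrite (prob_tau_par K1 hX) (prob_tau_par (stochastic_lazify K1) hY) -EFinD lee_fin.
  by apply: sched_le_lazy => // j; exact: par_step_occupied.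
- have K1 := stochastic_srw G.
  rewrite (prob_tau_par K1 hX) (prob_tau_par (stochastic_lazify K1) hY) -EFinD lee_fin.
  apply: sched_lazy_le => // [p|j]; first exact: srw_diag.
  exact: par_step_occupied.
Qed.

(** Along multiples of a fixed pair of times the bound is geometric; this is why tails are compared
    at multiples of fixed block lengths. *)
Lemma chernoffM (z : R) m r j : chernoff z (m * j) (r * j) = chernoff z m r ^+ j.
Proof. by rewrite /chernoff !exprM [RHS]exprMn [in RHS]exprVn. Qed.

Lemma bernoulli_inv (x : R) m : 0 <= x -> (1 + x) ^+ m * (1 - m%:R * x) <= 1.
Proof.
move=> x0; elim: m => [|m IH]; first by rewrite mul1r mul0r subr0.
apply: le_trans IH; rewrite exprS -mulrA mulrCA ler_wpM2l ?exprn_ge0 ?addr_ge0 //.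
rewrite -natr1; have := ler0n R m; nra.
Qed.

(** In [2 * m.+1] lazy steps the mean number of jumps is [m.+1], so at most [m] jumps is a deviation
    below the mean. *)
Lemma chernoff_rate_slow m : (1 < m)%N ->
  exists z : R, [/\ 0 < z, z <= 1 & chernoff z (2 * m.+1) m < 1].
Proof.
move=> m1; pose x : R := m%:R^-1.
have m0 : 0 < m%:R :> R by rewrite ltr0n ltnW.
have mx : m%:R * x = 1 by rewrite mulfV ?gt_eqF.
have x0 : 0 < x by rewrite invr_gt0.
have x2 : x <= 2^-1 by rewrite lef_pV2 ?posrE // (ler_nat _ 2).
exists (1 - x); split; [lra|lra|].
set z := 1 - x; have z0 : 0 < z by rewrite /z; lra.
(* [1 + dl] is the squared ratio of the arithmetic to the geometric mean of 1 and [z]; the Chernoff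
   bound becomes [z * (1 + dl) ^+ m.+1]. *)
pose dl := x ^+ 2 / (4 * z).
have dl0 : 0 <= dl by rewrite divr_ge0 ?sqr_ge0 ?mulr_ge0 // ltW.
have hw : ((1 + z) / 2) ^+ 2 = z * (1 + dl).
  by rewrite /dl /z; field; rewrite gt_eqF // -/z.
rewrite /chernoff exprM hw exprS exprMn.
rewrite [X in X < _](_ : _ = z * (1 + dl) * (1 + dl) ^+ m); last first.
  have : z ^+ m != 0 by rewrite expf_neq0 // gt_eqF.
  by move: (z ^+ m) ((1 + dl) ^+ m) => a b a0; field.
have md : m%:R * dl = x / (4 * z).
  by rewrite /dl expr2 -mulrA mulrA mx mul1r.
have h := bernoulli_inv m dl0; rewrite md in h.
have zd : z * (1 + dl) < 1 - x / (4 * z).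
  rewrite -hw ltrBrDr -ltrBrDl ltr_pdivrMr ?mulr_gt0 //; rewrite /z; nra.
have p0 : 0 < (1 + dl) ^+ m by rewrite exprn_gt0 //; lra.
by apply: lt_le_trans h; rewrite mulrC ltr_pM2l.
Qed.

(** In [2 * m] lazy steps the mean number of jumps is [m], so [m.+1] jumps is a deviation above it.
    Here the bound becomes [(1 + dl) ^+ m / z]. *)
Lemma chernoff_rate_fast m : (0 < m)%N ->
  exists z : R, 1 <= z /\ chernoff z (2 * m) m.+1 < 1.
Proof.
move=> m1; pose x : R := m%:R^-1.
have m0 : 0 < m%:R :> R by rewrite ltr0n.
have mx : m%:R * x = 1 by rewrite mulfV ?gt_eqF.
have x0 : 0 < x by rewrite invr_gt0.
exists (1 + x); split; first lra.
set z := 1 + x; have z0 : 0 < z by rewrite /z; lra.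
pose dl := x ^+ 2 / (4 * z).
have dl0 : 0 <= dl by rewrite divr_ge0 ?sqr_ge0 ?mulr_ge0 // ltW.
have hw : ((1 + z) / 2) ^+ 2 = z * (1 + dl).
  by rewrite /dl /z; field; rewrite gt_eqF // -/z.
rewrite /chernoff exprM hw exprS exprMn invfM -mulrA.
rewrite [X in _ * X]mulrA mulVf ?mul1r ?expf_neq0 ?gt_eqF // mulrC ltr_pdivrMr // mul1r.
have md : m%:R * dl = x / (4 * z).
  by rewrite /dl expr2 -mulrA mulrA mx mul1r.
have h := bernoulli_inv m dl0; rewrite md in h.
have zd : 1 < z * (1 - x / (4 * z)).
  by rewrite mulrBr mulr1 (_ : z * _ = x / 4); [rewrite /z; lra|field; rewrite gt_eqF].
have p0 : 0 < (1 + dl) ^+ m by rewrite exprn_gt0 //; lra.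
have : (1 + dl) ^+ m * 1 < (1 + dl) ^+ m * (z * (1 - x / (4 * z))) by rewrite ltr_pM2l.
by rewrite mulr1 mulrCA => /lt_le_trans; apply; rewrite -[leRHS]mulr1 ler_pM2l.
Qed.

End TailComparison.

(** * Asymptotics and block sums *)

Section Asymptotics.
Variable R : realType.

(** Bernoulli's inequality for [q = 1 / (1 + h)]: a decay of order [1 / i], which becomes polynomial
    of any degree after taking powers. *)
Lemma bernoulli_decay (q h : R) i : 0 <= q -> 0 <= h -> q * (1 + h) = 1 ->
  q ^+ i * (1 + i%:R * h) <= 1.
Proof.
move=> q0 h0 qh; elim: i => [|i IH]; first by rewrite mul0r addr0 mulr1.
apply: le_trans IH; rewrite exprSr -mulrA ler_wpM2l ?exprn_ge0 //.
have e1 : q * h = 1 - q by lra.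
rewrite -natr1 (_ : q * _ = q + q * h + i%:R * (q * h)); last by ring.
have := ler0n R i; rewrite e1; nra.
Qed.

Lemma near_le_powR (N : nat -> nat) (alpha A : R) : 0 < alpha -> N @ \oo --> \oo ->
  \forall k \near \oo, A <= (N k)%:R `^ alpha.
Proof.
move=> a0 Noo; pose A' := Num.max A 0; pose B := Num.truncn (A' `^ alpha^-1).
have A0 : 0 <= A' by rewrite /A' le_max lexx orbT.
have : \forall k \near \oo, (B.+1 <= N k)%N.
  exact: (Noo [set n | (B.+1 <= n)%N] (nbhs_infty_ge _)).
apply: filterS => k BN; apply: (@le_trans _ _ A'); first by rewrite /A' le_max lexx.
have -> : A' = (A' `^ alpha^-1) `^ alpha by rewrite -powRrM mulVf ?gt_eqF // powRr1.
apply: ge0_ler_powR; rewrite ?nnegrE ?powR_ge0 ?ler0n ?(ltW a0) //.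
apply: ltW; apply: lt_le_trans (truncnS_gt _) _.
by rewrite ler_nat.
Qed.

(** Exponential decay beats any power: with [y = N ^ alpha] and [J] proportional to [y], [q ^+ J] is
    at most a constant times [y ^- p], while [N <= y ^+ p.-1]. *)
Lemma near_threshold (N : nat -> nat) (alpha q e : R) (M : nat) :
  0 < alpha -> N @ \oo --> \oo -> 0 < q -> q < 1 -> 0 < e -> (0 < M)%N ->
  \forall k \near \oo, exists J : nat,
    [/\ (M <= J)%N, (M * J)%:R <= (N k)%:R `^ alpha & (N k)%:R * q ^+ J <= e].
Proof.
move=> a0 Noo q0 q1 e0 M0.
(* [p.-1] exceeds [1 / alpha], which gives [N k <= y ^+ p.-1] and leaves a factor [1 / y] to
   spare. *)
pose p := (Num.truncn alpha^-1).+2.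
pose h := q^-1 - 1.
have qh : q * (1 + h) = 1 by rewrite /h addrC subrK mulfV ?gt_eqF.
have h0 : 0 < h by rewrite /h subr_gt0 invf_gt1.
pose Mp : R := (M * p)%:R.
have Mp0 : 0 < Mp by rewrite ltr0n muln_gt0 M0.
(* Chosen so that [g * y <= Num.min 1 h * i.+1 <= 1 + i * h], because [i.+1] exceeds [y / Mp]. *)
pose g := Num.min 1 h / Mp.
have mh0 : 0 < Num.min 1 h by rewrite lt_min ltr01.
have g0 : 0 < g by rewrite divr_gt0.
have ny A := near_le_powR A a0 Noo.
apply: filterS3 (ny 1) (ny (Mp * M%:R)) (ny (e^-1 * g ^- p)) => k y1 yM ye.
set y := (N k)%:R `^ alpha in y1 yM ye *.
have y0 : 0 < y by exact: lt_le_trans y1.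
pose i := Num.truncn (y / Mp).
have yMp : 0 <= y / Mp by rewrite divr_ge0 // ltW.
have iy : i%:R <= y / Mp by rewrite truncn_le.
have yi : y / Mp < i.+1%:R by exact: truncnS_gt.
exists (p * i)%N; split.
- rewrite (@leq_trans i) // ?leq_pmull // /i truncn_ge_nat // ler_pdivlMr //.
  by rewrite mulrC.
- by rewrite mulnA natrM mulrC -ler_pdivlMr.
have gy : g * y <= 1 + i%:R * h.
  rewrite /g mulrAC -mulrA (@le_trans _ _ (Num.min 1 h * i.+1%:R)) //.
    by rewrite ler_wpM2l ?(ltW mh0) // ltW.
  rewrite -natr1 mulrDr mulr1 addrC lerD //; first by rewrite ge_min lexx.
  by rewrite mulrC ler_wpM2l // ge_min lexx orbT.
have qi : q ^+ i <= (g * y)^-1.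
  rewrite -[leRHS]mul1r ler_pdivlMr; last exact: mulr_gt0.
  apply: le_trans (bernoulli_decay i (ltW q0) (ltW h0) qh).
  by rewrite ler_wpM2l // exprn_ge0 // ltW.
have Ny : (N k)%:R <= y ^+ p.-1.
  rewrite -powR_mulrn ?(ltW y0) // /y -powRrM.
  have [N0|N0] := posnP (N k); first by rewrite N0 powR_ge0.
  apply: le1r_powR; first by rewrite ler1n.
  rewrite mulrC -ler_pdivrMr // div1r /p /=; apply: ltW; exact: truncnS_gt.
have -> : q ^+ (p * i) = (q ^+ i) ^+ p by rewrite -exprM mulnC.
apply: (@le_trans _ _ (y ^+ p.-1 * (g * y)^-1 ^+ p)).
  have qi0 : 0 <= q ^+ i by rewrite exprn_ge0 // ltW.
  have gy0 : 0 <= (g * y)^-1 by rewrite invr_ge0 mulr_ge0 // ltW.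
  by apply: ler_pM => //; [exact: exprn_ge0|exact: lerXn2r].
have -> : y ^+ p.-1 * (g * y)^-1 ^+ p = g ^- p / y.
  rewrite exprVn exprMn [y ^+ p]exprSr.
  have : g ^+ p != 0 by rewrite expf_neq0 // gt_eqF.
  have : y ^+ p.-1 != 0 by rewrite expf_neq0 // gt_eqF.
  by move: (g ^+ p) (y ^+ p.-1) => a b b0 a1; field; rewrite a1 b0 gt_eqF.
by rewrite ler_pdivrMr // -ler_pdivrMl.
Qed.

End Asymptotics.

(** * Sums of nonincreasing sequences over blocks *)

Section BlockSums.
Variable R : realType.
Implicit Types (f g : nat -> R) (q : R).

Lemma sum_blocks_le f p M : {homo f : s t / (s <= t)%N >-> t <= s} ->
  \sum_(0 <= u < p * M) f u <= p%:R * \sum_(0 <= j < M) f (p * j)%N.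
Proof.
move=> hf; elim: M => [|M IH]; first by rewrite muln0 !big_geq // mulr0.
rewrite mulnS addnC (big_cat_nat (n := (p * M)%N)) ?leq_addr //= big_nat_recr //= mulrDr.
rewrite lerD // (@le_trans _ _ (\sum_(p * M <= u < p * M + p) f (p * M)%N)) //.
  by rewrite ler_sum_nat // => u /andP[hu _]; exact: hf.
by rewrite sumr_const_nat addKn mulr_natl.
Qed.

Lemma sum_blocks_ge f p M : {homo f : s t / (s <= t)%N >-> t <= s} ->
  p%:R * \sum_(0 <= j < M) f (p * j.+1)%N <= \sum_(0 <= u < p * M) f u.
Proof.
move=> hf; elim: M => [|M IH]; first by rewrite muln0 !big_geq // mulr0.
rewrite [in leRHS]mulnS addnC [leRHS](big_cat_nat (n := (p * M)%N)) ?leq_addr //=.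
rewrite big_nat_recr //= mulrDr.
rewrite lerD // (@le_trans _ _ (\sum_(p * M <= u < p * M + p) f (p * M.+1)%N)) //.
  by rewrite sumr_const_nat addKn mulr_natl.
rewrite ler_sum_nat // => u /andP[_ hu]; apply: hf.
by rewrite mulnS addnC ltnW.
Qed.

Lemma sum_geometric_tail_le q J M : 0 < q -> q < 1 ->
  \sum_(0 <= j < M) (J <= j)%N%:R * q ^+ j <= q ^+ J / (1 - q).
Proof.
move=> q0 q1; have q1' : 0 < 1 - q by rewrite subr_gt0.
suff : \sum_(0 <= j < M) (J <= j)%N%:R * q ^+ j <= (q ^+ J - q ^+ (maxn J M)) / (1 - q).
  move/le_trans; apply; rewrite ler_pM2r ?invr_gt0 // lerBlDr lerDl.
  by rewrite exprn_ge0 // ltW.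
elim: M => [|M IH]; first by rewrite big_geq // maxn0 subrr mul0r.
rewrite big_nat_recr //=; have [JM|MJ] := leqP J M.
  rewrite (maxn_idPr (leqW JM)); rewrite (maxn_idPr JM) in IH.
  rewrite mul1r; apply: le_trans (lerD IH (lexx _)) _.
  rewrite exprS le_eqVlt; apply/orP; left; apply/eqP; field.
  by rewrite subr_eq0 gt_eqF.
by rewrite mul0r addr0 (maxn_idPl MJ); rewrite (maxn_idPl (ltnW MJ)) in IH.
Qed.

(** Sum by blocks of length [p1] for [f] and [p2] for [g]. The constant [J.+1] counts the first [J]
    blocks, where only [f <= 1] is known, and one block lost in passing from block starts to block
    ends for [g]. *)
Lemma sum_tail_compare f g q c (p1 p2 J : nat) :
  {homo f : s t / (s <= t)%N >-> t <= s} -> {homo g : s t / (s <= t)%N >-> t <= s} ->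
  (forall s, 0 <= f s <= 1) -> (forall s, 0 <= g s <= 1) ->
  0 < q -> q < 1 -> 0 <= c -> (0 < p1)%N -> (0 < p2)%N ->
  (forall j, (J <= j)%N -> f (p1 * j)%N <= g (p2 * j)%N + c * q ^+ j) ->
  (\sum_(0 <= u <oo) (f u)%:E <= (p1%:R / p2%:R)%:E * \sum_(0 <= s <oo) (g s)%:E +
     (p1%:R * (J.+1%:R + c * q ^+ J / (1 - q)))%:E)%E.
Proof.
move=> hf hg f01 g01 q0 q1 c0 p10 p20 fg.
have f0 s : (0 <= (f s)%:E)%E by rewrite lee_fin; case/andP: (f01 s).
have g0 s : (0 <= (g s)%:E)%E by rewrite lee_fin; case/andP: (g01 s).
apply: lime_le; first by apply: is_cvg_nneseries => *; exact: f0.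
apply: nearW => M.
have p2' : 0 < p2%:R :> R by rewrite ltr0n.
have hM : \sum_(0 <= u < M) f u <= p1%:R / p2%:R * (\sum_(0 <= s < p2 * M) g s) +
    p1%:R * (J.+1%:R + c * q ^+ J / (1 - q)).
  apply: (@le_trans _ _ (\sum_(0 <= u < p1 * M) f u)).
    rewrite [leRHS](big_cat_nat (n := M)) ?leq_pmull //= lerDl.
    by apply: sumr_ge0 => u _; rewrite -lee_fin.
  apply: le_trans (sum_blocks_le _ _ hf) _.
  rewrite -mulrA -mulrDr ler_wpM2l //.
  have hj j : f (p1 * j)%N <= (j < J)%N%:R + (g (p2 * j)%N + c * ((J <= j)%N%:R * q ^+ j)).
    have [Jj|jJ] := leqP J j; first by rewrite add0r mul1r fg.
    have /andP[g0j _] := g01 (p2 * j)%N; have /andP[_ f1j] := f01 (p1 * j)%N.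
    by rewrite mul0r mulr0 addr0 ler_wpDr.
  apply: le_trans (ler_sum_nat (fun j _ => hj j)) _.
  rewrite !big_split /= -mulr_sumr.
  have h1 : \sum_(0 <= j < M) (j < J)%N%:R <= J%:R :> R.
    rewrite -natr_sum ler_nat big_mkord; elim: (M) {1 2}(J) => [|M' IH] J'.
      by rewrite big_ord0.
    rewrite big_ord_recl /=; case: J' => [|J']; first by rewrite big1.
    rewrite add1n ltnS; apply: leq_trans (IH J').
    by rewrite leq_eqVlt; apply/orP; left; apply/eqP; apply: eq_bigr.
  (* Each block start is the end of the preceding block, except the first, which contributes at most
     1. *)
  have h2 : \sum_(0 <= j < M) g (p2 * j)%N <= 1 + p2%:R^-1 * \sum_(0 <= s < p2 * M) g s.
    apply: (@le_trans _ _ (1 + \sum_(0 <= j < M) g (p2 * j.+1)%N)).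
      case: M {h1} => [|M]; first by rewrite !big_geq // addr0 ler01.
      rewrite big_nat_recl // lerD //; first by case/andP: (g01 (p2 * 0)%N).
      rewrite [leRHS]big_nat_recr //= lerDl; by case/andP: (g01 (p2 * M.+1)%N).
    by rewrite lerD2l ler_pdivlMl //; exact: sum_blocks_ge.
  have h3 : c * \sum_(0 <= j < M) (J <= j)%N%:R * q ^+ j <= c * q ^+ J / (1 - q).
    by rewrite -mulrA ler_wpM2l //; exact: sum_geometric_tail_le.
  by rewrite -natr1; lra.
rewrite sumEFin; apply: (@le_trans _ _ (p1%:R / p2%:R * (\sum_(0 <= s < p2 * M) g s) +
    p1%:R * (J.+1%:R + c * q ^+ J / (1 - q)))%:E); first by rewrite lee_fin.
rewrite EFinD EFinM leeD2r // lee_wpmul2l ?lee_fin ?divr_ge0 //.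
by rewrite -sumEFin; apply: nneseries_lim_ge => *; exact: g0.
Qed.

End BlockSums.

(** * Tails and levels of a variable with values in the extended naturals *)

Section Tails.
Variables (R : realType) (d : measure_display) (Omega : measurableType d).
Variables (P : probability Omega R) (T : Omega -> \bar R).
Hypothesis T_nat : forall w, T w = +oo%E \/ exists t : nat, T w = t%:R%:E.
Hypothesis T_meas : forall t : nat, measurable [set w | (T w <= t%:R%:E)%E].

Definition tail (s : nat) : R := fine (P [set w | (s%:R%:E < T w)%E]).

Lemma tail_setC s : [set w | (s%:R%:E < T w)%E] = ~` [set w | (T w <= s%:R%:E)%E].
Proof.
apply/seteqP; split=> w /=; first by move=> h; apply/negP; rewrite -ltNge.
by move/negP; rewrite -ltNge.
Qed.

Lemma measurable_tail s : measurable [set w | (s%:R%:E < T w)%E].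
Proof. by rewrite tail_setC; apply: measurableC. Qed.

Lemma tailE s : P [set w | (s%:R%:E < T w)%E] = (tail s)%:E.
Proof. by rewrite /tail fineK // fin_num_measure //; exact: measurable_tail. Qed.

Lemma prob_leE s : P [set w | (T w <= s%:R%:E)%E] = (1 - tail s)%:E.
Proof.
rewrite -[X in P X]setCK -tail_setC probability_setC; last exact: measurable_tail.
by rewrite tailE -EFinB.
Qed.

Lemma tail_bound s : 0 <= tail s <= 1.
Proof.
by rewrite -!lee_fin -tailE measure_ge0 probability_le1 //; exact: measurable_tail.
Qed.

Lemma tail_anti : {homo tail : s t / (s <= t)%N >-> t <= s}.
Proof.
move=> s t st; rewrite -lee_fin -!tailE; apply: le_measure; rewrite ?inE.
- exact: measurable_tail.
- exact: measurable_tail.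
- by move=> w /=; apply: le_lt_trans; rewrite lee_fin ler_nat.
Qed.

(** Index 0 stands for the value [+oo] and [t.+1] for the value [t], so the levels form a partition
    indexed by the naturals. *)
Definition level (i : nat) : set Omega :=
  [set w | T w = if i is t.+1 then t%:R%:E else +oo%E].

Lemma measurable_level i : measurable (level i).
Proof.
case: i => [|t].
  have -> : level 0 = \bigcap_s [set w | (s%:R%:E < T w)%E].
    apply/seteqP; split=> w; rewrite /level /=; first by move=> h s _ /=; rewrite h ltry.
    by case: (T_nat w) => [//|[t Tw] /(_ t I)]; rewrite /= Tw ltxx.
  by apply: bigcapT_measurable => s; exact: measurable_tail.
have -> : level t.+1 = [set w | (T w <= t%:R%:E)%E] `&`
    (if t is s.+1 then [set w | (s%:R%:E < T w)%E] else setT).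
  apply/seteqP; split=> w; rewrite /level /=.
    move=> h; split; first by rewrite /= h.
  by case: t h => //= s ->; rewrite lte_fin ltr_nat.
  case: (T_nat w) => [->|[u Tw]]; first by rewrite leye_eq => -[].
  rewrite Tw.
  rewrite lee_fin ler_nat => -[ut hu]; congr (_%:R%:E).
  apply/eqP; rewrite eqn_leq ut /=.
  by case: t hu ut => //= s; rewrite Tw lte_fin ltr_nat.
apply: measurableI => //; case: t => // s; exact: measurable_tail.
Qed.

Lemma level_cover w : exists i, level i w.
Proof. by case: (T_nat w) => [h|[t h]]; [exists 0%N|exists t.+1]. Qed.

Lemma level_inj i j w : level i w -> level j w -> i = j.
Proof.
rewrite /level /= => ->; case: i j => [|t] [|u] //= [/eqP].
by rewrite eqr_nat => /eqP ->.
Qed.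

(** [B] is arbitrary: as [T] takes countably many values, its preimage is a countable union of
    levels. *)
Lemma measurable_nat_valued (B : set (\bar R)) : measurable (T @^-1` B).
Proof.
have -> : T @^-1` B = \bigcup_(i in [set i | level i `&` (T @^-1` B) !=set0]) level i.
  apply/seteqP; split=> w; last first.
    by move=> [i [w' [lw' Bw']] lw]; rewrite /preimage /= lw -lw'.
  by move=> Bw; have [i lw] := level_cover w; exists i => //; exists w.
by apply: bigcup_measurable => i _; exact: measurable_level.
Qed.

(** [T w] counts the [s] with [s < T w], also when it is infinite, and the series of nonnegative
    indicators may be integrated term by term. *)
Lemma integral_tail : (\int[P]_w T w = \sum_(0 <= s <oo) (tail s)%:E)%E.
Proof.
have TE w : T w = (\sum_(0 <= s <oo) (\1_[set w | (s%:R%:E < T w)%E] w)%:E)%E.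
  have ind s : \1_[set w | (s%:R%:E < T w)%E] w = (s%:R%:E < T w)%E%:R :> R.
    rewrite indicE; congr (_%:R); congr nat_of_bool; apply/idP/idP.
      by rewrite inE.
    by move=> h; rewrite inE.
  have [Tw|[t Tw]] := T_nat w.
  - rewrite Tw; apply/esym; apply: eq_infty => t.
    pose M := (Num.truncn t).+1.
    apply: le_trans (_ : (\sum_(0 <= s < M) (\1_[set w | (s%:R%:E < T w)%E] w)%:E <= _)%E).
      rewrite (eq_bigr (fun=> 1%:E)) => [|s _]; last by rewrite ind Tw ltry.
      by rewrite sumEFin sumr_const_nat subn0 lee_fin -[_ *+ _]/(_%:R) ltW // truncnS_gt.
    by apply: nneseries_lim_ge => s _; rewrite lee_fin ind.
  - rewrite (nneseries_split _ t); last by move=> s _; rewrite lee_fin ind.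
    rewrite add0n (eq_big_nat _ _ (F2 := fun=> 1%:E)); last first.
      by move=> s /andP[_ st]; rewrite ind Tw lte_fin ltr_nat st.
    rewrite eseries0 ?adde0; last first.
      by move=> s st _; rewrite ind Tw lte_fin ltr_nat ltnNge st.
    by rewrite sumEFin sumr_const_nat subn0 Tw.
under eq_integral do rewrite TE.
rewrite integral_nneseries //.
- apply: eq_eseriesr => s _; rewrite integral_indic //; last exact: measurable_tail.
  by rewrite setIT; exact: tailE.
- move=> s; apply/measurable_EFinP; apply: measurable_indic; exact: measurable_tail.
Qed.

End Tails.

(** * Expectations *)

Section LazyMean.
Variables (R : realType) (tau : dispersion_time R).
Hypothesis H : lazy_comparable tau.

(** The ratio [q] depends on [m] alone and serves all graphs and both directions. *)
Lemma tail_compare m : (1 < m)%N -> exists q : R, [/\ 0 < q, q < 1 &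
  forall (G : cgraph) (v : G) d d' (Omega : measurableType d) (Omega' : measurableType d')
    (P : probability Omega R) (P' : probability Omega' R) X Y,
    (1 < #|G|)%N -> indep_walks (@srw R G) v P X -> indep_walks (@lazy_rw R G) v P' Y ->
    forall j,
      tail P' (fun w => @tau G (Y w)) (2 * m.+1 * j) <=
        tail P (fun w => @tau G (X w)) (m * j) + #|G|%:R * q ^+ j /\
      tail P (fun w => @tau G (X w)) (m.+1 * j) <=
        tail P' (fun w => @tau G (Y w)) (2 * m * j) + #|G|%:R * q ^+ j].
Proof.
move=> m1.
have [z1 [z10 z11 q1]] := chernoff_rate_slow R m1.
have [z2 [z21 q2]] := chernoff_rate_fast R (ltnW m1).
have z20 : 0 < z2 by exact: lt_le_trans z21.
set c1 := chernoff z1 _ _ in q1; set c2 := chernoff z2 _ _ in q2.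
have c10 : 0 <= c1 by exact: chernoff_ge0.
have c20 : 0 <= c2 by exact: chernoff_ge0.
(* The maximum with [2^-1] ensures [0 < q]. *)
pose q := Num.max (Num.max c1 c2) (2^-1).
have q0 : 0 < q by rewrite /q lt_max invr_gt0 ltr0n orbT.
exists q; split=> //; first by rewrite /q !gt_max q1 q2 invf_lt1 // ltr1n.
have c1q : c1 <= q by rewrite /q !le_max lexx.
have c2q : c2 <= q by rewrite /q !le_max lexx orbT.
move=> G v d d' Om Om' P P' X Y G1 hX hY j.
have nX w := lc_nat H (X w); have nY w := lc_nat H (Y w).
have mX t := lc_measurable H t hX; have mY t := lc_measurable H t hY.
split.
  have := lc_le H (m * j) (2 * m.+1 * j) hX hY z10 z11.
  rewrite chernoffM (prob_leE P mX) (prob_leE P' mY) -EFinD lee_fin -/c1.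
  have : #|G|%:R * c1 ^+ j <= #|G|%:R * q ^+ j.
    by rewrite ler_wpM2l // lerXn2r // nnegrE // ltW.
  lra.
have := lc_ge H (m.+1 * j) (2 * m * j) G1 hX hY z21.
rewrite chernoffM (prob_leE P mX) (prob_leE P' mY) -EFinD lee_fin -/c2.
have : #|G|%:R * c2 ^+ j <= #|G|%:R * q ^+ j.
  by rewrite ler_wpM2l // lerXn2r // nnegrE // ltW.
lra.
Qed.

Variables (G : nat -> cgraph) (v : forall k, G k) (alpha beta : R)
  (d : nat -> measure_display) (Omega : forall k, measurableType (d k))
  (P : forall k, probability (Omega k) R)
  (X : forall k, Omega k -> 'I_#|G k| -> nat -> G k)
  (d' : nat -> measure_display) (Omega' : forall k, measurableType (d' k))
  (P' : forall k, probability (Omega' k) R)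
  (Y : forall k, Omega' k -> 'I_#|G k| -> nat -> G k).
Arguments X : clear implicits.
Arguments Y : clear implicits.
Hypotheses (alpha0 : 0 < alpha) (beta0 : 0 < beta).
Hypothesis Goo : (fun k => #|G k|) @ \oo --> \oo.
Hypothesis hX : forall k, indep_walks (@srw R (G k)) (v k) (P k) (X k).
Hypothesis hY : forall k, indep_walks (@lazy_rw R (G k)) (v k) (P' k) (Y k).
Hypothesis hlarge : large_whp tau alpha beta P X.

Let TX k w := @tau (G k) (X k w).
Let TY k w := @tau (G k) (Y k w).
Arguments TX : clear implicits.
Arguments TY : clear implicits.
Let TXn k w : TX k w = +oo%E \/ exists t : nat, TX k w = t%:R%:E.
Proof. exact: (lc_nat H (X k w)). Qed.
Let TYn k w : TY k w = +oo%E \/ exists t : nat, TY k w = t%:R%:E.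
Proof. exact: (lc_nat H (Y k w)). Qed.
Let TXm k t : measurable [set w | (TX k w <= t%:R%:E)%E].
Proof. exact: (lc_measurable H t (hX k)). Qed.
Let TYm k t : measurable [set w | (TY k w <= t%:R%:E)%E].
Proof. exact: (lc_measurable H t (hY k)). Qed.
Local Notation a k := (tail (P k) (TX k)).
Local Notation b k := (tail (P' k) (TY k)).

(** A threshold [J] separates two regimes: before [M * J] the tail of the simple process is nearly
    1, because [M * J <= n ^ alpha], and from [J] on the errors have a total of at most [e]. *)
Lemma near_tail_compare m M (e : R) : (1 < m)%N -> (0 < M)%N -> 0 < e ->
  \forall k \near \oo, exists q J,
    [/\ 0 < q < 1, (M <= J)%N, #|G k|%:R * q ^+ J / (1 - q) <= e,
      forall s, (s < M * J)%N -> 1 - e <= a k s &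
      forall j, b k (2 * m.+1 * j) <= a k (m * j) + #|G k|%:R * q ^+ j /\
                a k (m.+1 * j) <= b k (2 * m * j) + #|G k|%:R * q ^+ j].
Proof.
move=> m1 M0 e0; have [q [q0 q1 hq]] := tail_compare m1.
(* The factor [1 - q] anticipates the geometric sum of the errors. *)
have e0' : 0 < e * (1 - q) by rewrite mulr_gt0 // subr_gt0.
have n1 : \forall k \near \oo, (1 < #|G k|)%N.
  exact: (Goo (nbhs_infty_ge 2)).
have nb := near_le_powR e^-1 beta0 Goo.
near=> k.
have [J [MJ JM Jq]] : exists J : nat, [/\ (M <= J)%N,
    (M * J)%:R <= #|G k|%:R `^ alpha & #|G k|%:R * q ^+ J <= e * (1 - q)].
  by near: k; exact: near_threshold.
exists q, J; split=> //.
- by rewrite q0.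
- by rewrite ler_pdivrMr // subr_gt0.
- move=> s sMJ; rewrite -lee_fin -(tailE _ (TXm k)).
  have eb : #|G k|%:R `^ (- beta) <= e.
    have nb0 : 0 < #|G k|%:R `^ beta by rewrite powR_gt0 // ltr0n ltnW //; near: k.
    rewrite powRN invf_ple ?posrE //; near: k; exact: nb.
  apply: (@le_trans _ _ (1 - #|G k|%:R `^ (- beta))%:E); first by rewrite lee_fin; lra.
  apply: (@le_trans _ _ (P k [set w | (#|G k|%:R `^ alpha)%:E <= @tau (G k) (X k w)]))%E.
    by near: k.
  have sub : [set w | (#|G k|%:R `^ alpha)%:E <= @tau (G k) (X k w)]%E `<=`
      [set w | s%:R%:E < TX k w]%E.
    move=> w /=; apply: lt_le_trans; rewrite lte_fin; apply: lt_le_trans JM.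
    by rewrite ltr_nat.
  apply: le_measure sub; rewrite inE; last exact: measurable_tail.
  exact: (measurable_nat_valued (@TXn k) (@TXm k) [set x | (#|G k|%:R `^ alpha)%:E <= x]%E).
- by apply: hq (hX k) (hY k); near: k.
Unshelve. all: by end_near. Qed.

(** The block comparison has an additive error of order [J]; it is absorbed because the tail is at
    least [1 / 2] over a much longer range. *)
Lemma near_mean m : (1 < m)%N -> \forall k \near \oo,
  (\int[P k]_w TX k w = +oo /\ \int[P' k]_w TY k w = +oo)%E \/
  exists x y : R, [/\ (\int[P k]_w TX k w = x%:E)%E, (\int[P' k]_w TY k w = y%:E)%E,
    0 < x & `|y / (2 * x) - 1| <= 3 / m%:R].
Proof.
move=> m1; have half0 : 0 < 2^-1 :> R by rewrite invr_gt0.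
(* This range makes the mean [x] at least [4 * m * m.+1 * J], while [C <= 2 * J]; hence
   [m * m.+1 * C <= x / 2]. *)
have M0 : (0 < 8 * m * m.+1)%N by rewrite !muln_gt0 (ltnW m1).
apply: filterS (near_tail_compare m1 M0 half0) => k [q [J]].
move=> [/andP[q0 q1] MJ nq ha hab].
have J2 : (2 <= J)%N by apply: leq_trans MJ; nia.
have ea := integral_tail (P k) (@TXn k) (@TXm k).
have eb := integral_tail (P' k) (@TYn k) (@TYm k).
have ba := @sum_tail_compare R (b k) (a k) q #|G k|%:R (2 * m.+1) m J
  (tail_anti (P' k) (@TYm k)) (tail_anti (P k) (@TXm k))
  (tail_bound (P' k) (@TYm k)) (tail_bound (P k) (@TXm k)) q0 q1 (ler0n _ _) isT (ltnW m1)
  (fun j _ => (hab j).1).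
have m20 : (0 < 2 * m)%N by rewrite muln_gt0 (ltnW m1).
have ab := @sum_tail_compare R (a k) (b k) q #|G k|%:R m.+1 (2 * m) J
  (tail_anti (P k) (@TXm k)) (tail_anti (P' k) (@TYm k))
  (tail_bound (P k) (@TXm k)) (tail_bound (P' k) (@TYm k)) q0 q1 (ler0n _ _) isT m20
  (fun j _ => (hab j).2).
rewrite -ea -eb in ba ab.
have x0 : ((4 * m * m.+1 * J)%:R%:E <= \int[P k]_w TX k w)%E.
  rewrite ea; apply: (@le_trans _ _ (\sum_(0 <= s < 8 * m * m.+1 * J) (a k s)%:E)%E).
    rewrite sumEFin lee_fin (@le_trans _ _ (\sum_(0 <= s < 8 * m * m.+1 * J) 2^-1)) //.
      rewrite sumr_const_nat subn0 -[leRHS]mulr_natl -!mulnA (natrM _ 8) (natrM _ 4).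
      by rewrite mulrAC (_ : 8%:R * 2^-1 = 4%:R :> R) //; lra.
    by apply: ler_sum_nat => s /andP[_ /ha]; lra.
  apply: nneseries_lim_ge => s _.
  by rewrite lee_fin; case/andP: (tail_bound (P k) (@TXm k) s).
have y0 : (0 <= \int[P' k]_w TY k w)%E.
  rewrite eb; apply: nneseries_ge0 => s _ _.
  by rewrite lee_fin; case/andP: (tail_bound (P' k) (@TYm k) s).
set C := J.+1%:R + _ in ba ab.
have CJ : C <= 2 * J%:R.
  have : 2 <= J%:R :> R by rewrite (ler_nat _ 2).
  by rewrite /C -natr1; lra.
have m0 : 0 < m%:R :> R by rewrite ltr0n ltnW.
move: x0 y0 ab ba.
(* The bounds [ab] and [ba] exclude that exactly one mean is infinite; [x0] and [y0] exclude
   [-oo]. *)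
case: (\int[P k]_w TX k w)%E => [x| |]; case: (\int[P' k]_w TY k w)%E => [y| |] //.
- rewrite !lee_fin => x0 y0 ab ba; right; exists x, y.
  have J0 : 2 <= J%:R :> R by rewrite (ler_nat _ 2).
  have x0' : 4 * m%:R * (m%:R + 1) * J%:R <= x by rewrite natr1 -!natrM.
  have xp : 0 < x by apply: lt_le_trans x0'; rewrite !mulr_gt0 //; lra.
  split=> //; rewrite natrM -[m.+1%:R]natr1 in ba.
  rewrite natrM -[m.+1%:R]natr1 in ab.
  have ab' : 2 * m%:R * x <= (m%:R + 1) * y + 2 * m%:R * ((m%:R + 1) * C).
    apply: (@le_trans _ _ (2 * m%:R * ((m%:R + 1) / (2 * m%:R) * y + (m%:R + 1) * C))).
      by rewrite ler_pM2l // mulr_gt0.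
    by rewrite mulrDr le_eqVlt; apply/orP; left; apply/eqP; field; rewrite gt_eqF.
  have ba' : m%:R * y <= 2 * (m%:R + 1) * x + m%:R * (2 * (m%:R + 1) * C).
    apply: (@le_trans _ _ (m%:R * (2 * (m%:R + 1) / m%:R * x + 2 * (m%:R + 1) * C))).
      by rewrite ler_pM2l.
    by rewrite mulrDr le_eqVlt; apply/orP; left; apply/eqP; field; rewrite gt_eqF.
  have mC : m%:R * (m%:R + 1) * C <= x / 2.
    apply: (@le_trans _ _ (m%:R * (m%:R + 1) * (2 * J%:R))); last by lra.
    by rewrite ler_wpM2l // mulr_ge0 //; lra.
  rewrite (_ : y / (2 * x) - 1 = (y - 2 * x) / (2 * x)); last by field; rewrite gt_eqF.
  have x2 : 0 < 2 * x by rewrite mulr_gt0.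
  rewrite normrM normfV (gtr0_norm x2) ler_pdivrMr //.
  rewrite mulrAC ler_pdivlMr //.
  have [yx|yx] := leP 0 (y - 2 * x).
    by rewrite ger0_norm //; lra.
  rewrite ltr0_norm //; lra.
- by move=> *; left.
Qed.

Lemma mean_double_of_comparable : mean_double tau P X P' Y.
Proof.
(* When the simple mean is infinite so is, eventually, the lazy one, and the default 0 gives the
   equality. *)
pose eps k : R := if (\int[P k]_w TX k w)%E is x%:E
  then fine (\int[P' k]_w TY k w)%E / (2 * x) - 1 else 0.
exists eps.
  apply/cvgrPdist_le => e e0; pose m := (Num.truncn (3 / e)).+2.
  have me : 3 / e < m%:R by apply: lt_trans (truncnS_gt _) _; rewrite ltr_nat.
  have em : 3 / m%:R <= e.
    by rewrite ler_pdivrMr ?ltr0n // mulrC -ler_pdivrMr // ltW.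
  apply: filterS (near_mean (m := m) isT) => k h; rewrite sub0r normrN /eps.
  case: h => [[-> _]|[x [y [-> -> x0 h]]]]; first by rewrite normr0 ltW.
  exact: le_trans h em.
apply: filterS (near_mean (m := 2) isT) => k; rewrite -/(TX k) -/(TY k) /eps.
case=> [[-> ->]|[x [y [-> -> x0 _]]]].
  by rewrite addr0 mulr1 gt0_muley // lte_fin.
by rewrite -EFinM /=; congr EFin; field; rewrite gt_eqF.
Qed.


End LazyMean.

(** * Quantile coupling *)

Section Glue.
Variables (R : realType) (d1 d2 : measure_display).
Variables (T1 : measurableType d1) (T2 : measurableType d2).
Variables (P1 : probability T1 R) (P2 : probability T2 R).
Variables (D1 : nat -> set T1) (D2 : nat -> set T2).
Hypotheses (mD1 : forall i, measurable (D1 i)) (mD2 : forall i, measurable (D2 i)).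
Hypotheses (cover1 : \bigcup_i D1 i = setT) (cover2 : \bigcup_i D2 i = setT).
Hypotheses (triv1 : trivIset setT D1) (triv2 : trivIset setT D2).
Hypothesis P12 : forall i, P1 (D1 i) = P2 (D2 i).

Let mD i : measurable (D1 i `*` D2 i).
Proof. exact: measurableX. Qed.

Let inv_ge0 i : 0 <= (fine (P1 (D1 i)))^-1.
Proof. by rewrite invr_ge0 fine_ge0. Qed.

(* Conditionally on the common class i, the two components are independent. *)
Definition glue : set (T1 * T2) -> \bar R :=
  mseries (fun i => mscale (NngNum (inv_ge0 i)) (mrestr (P1 \x P2)%E (mD i))) 0.

HB.instance Definition _ := Measure.on glue.

Let glueE E : glue E = (\sum_(0 <= i <oo)
  ((fine (P1 (D1 i)))^-1)%:E * (P1 \x P2) (E `&` (D1 i `*` D2 i)))%E.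
Proof. by []. Qed.

Let prob_cover1 A : measurable A -> P1 A = (\sum_(0 <= i <oo) P1 (A `&` D1 i))%E.
Proof.
move=> mA; rewrite -[in LHS](setIT A) -cover1 setI_bigcupr measure_bigcup //=.
- by apply: eq_eseriesl => i; rewrite in_setT.
- by move=> i _; exact: measurableI.
- exact: trivIset_setIl.
Qed.

Let prob_cover2 A : measurable A -> P2 A = (\sum_(0 <= i <oo) P2 (A `&` D2 i))%E.
Proof.
move=> mA; rewrite -[in LHS](setIT A) -cover2 setI_bigcupr measure_bigcup //=.
- by apply: eq_eseriesl => i; rewrite in_setT.
- by move=> i _; exact: measurableI.
- exact: trivIset_setIl.
Qed.

Let prodE A B : measurable A -> measurable B ->
  (P1 \x P2)%E (A `*` B) = (P1 A * P2 B)%E.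
Proof. exact: product_measure1E. Qed.

Lemma glue_fst A : measurable A -> glue (fst @^-1` A) = P1 A.
Proof.
move=> mA; rewrite glueE prob_cover1 //; apply: eq_eseriesr => i _.
have -> : fst @^-1` A `&` (D1 i `*` D2 i) = (A `&` D1 i) `*` D2 i.
  by apply/seteqP; split=> -[x y] /=; rewrite /preimage /=; tauto.
rewrite prodE //; last exact: measurableI.
rewrite -P12 muleCA.
have fin : P1 (D1 i) \is a fin_num by rewrite fin_num_measure.
have [p0|p0] := eqVneq (fine (P1 (D1 i))) 0.
  have P0 : P1 (D1 i) = 0%E by rewrite -(fineK fin) p0.
  rewrite P0 mule0 mule0; apply/esym/eqP; rewrite eq_le measure_ge0 andbT -P0.
  by apply: le_measure; rewrite ?inE //; exact: measurableI.
by rewrite -{2}(fineK fin) -EFinM mulVf // mule1.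
Qed.

Lemma glue_snd A : measurable A -> glue (snd @^-1` A) = P2 A.
Proof.
move=> mA; rewrite glueE prob_cover2 //; apply: eq_eseriesr => i _.
have -> : snd @^-1` A `&` (D1 i `*` D2 i) = D1 i `*` (A `&` D2 i).
  by apply/seteqP; split=> -[x y] /=; rewrite /preimage /=; tauto.
rewrite prodE //; last exact: measurableI.
rewrite muleA.
have fin : P1 (D1 i) \is a fin_num by rewrite fin_num_measure.
have [p0|p0] := eqVneq (fine (P1 (D1 i))) 0.
  have P0 : P1 (D1 i) = 0%E by rewrite -(fineK fin) p0.
  rewrite P0 mule0 mul0e; apply/esym/eqP; rewrite eq_le measure_ge0 andbT -P0 P12.
  by apply: le_measure; rewrite ?inE //; exact: measurableI.
by rewrite -{2}(fineK fin) -EFinM mulVf // mul1e.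
Qed.

Let glue_setT : glue setT = 1%:E.
Proof. by rewrite -(@preimage_setT _ _ fst) glue_fst // probability_setT. Qed.

HB.instance Definition _ := Measure_isProbability.Build _ _ _ glue glue_setT.

Lemma glue_diag : glue (\bigcup_i (D1 i `*` D2 i)) = 1%E.
Proof.
rewrite -glue_setT !glueE; apply: eq_eseriesr => i _; congr (_ * _)%E; congr (_ _).
rewrite setTI; apply/seteqP; split=> w; first by case.
by move=> Dw; split=> //; exists i.
Qed.

(** Used twice below: to attach a uniform variable to the simple process, then the lazy process to
    that variable. *)
Lemma glue_exists : exists Q : probability (T1 * T2)%type R,
  [/\ forall A, measurable A -> Q (fst @^-1` A) = P1 A,
      forall A, measurable A -> Q (snd @^-1` A) = P2 A &
      Q (\bigcup_i (D1 i `*` D2 i)) = 1%E].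
Proof. by exists glue; split; [exact: glue_fst|exact: glue_snd|exact: glue_diag]. Qed.

End Glue.

Section LevelLaw.
Variables (R : realType) (d : measure_display) (Omega : measurableType d).
Variables (P : probability Omega R) (T : Omega -> \bar R).
Hypothesis T_nat : forall w, T w = +oo%E \/ exists t : nat, T w = t%:R%:E.
Hypothesis T_meas : forall t : nat, measurable [set w | (T w <= t%:R%:E)%E].

Lemma prob_levelS t : P (level T t.+1) =
  ((if t is s.+1 then tail P T s else 1) - tail P T t)%:E.
Proof.
case: t => [|s].
  rewrite -(prob_leE P T_meas); congr (P _); apply/seteqP; split=> w.
    by rewrite /level /= => ->.
  rewrite /level /=; case: (T_nat w) => [->|[u ->]]; first by rewrite leye_eq.
  by rewrite lee_fin ler_nat leqn0 => /eqP ->.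
have -> : level T s.+2 = [set w | (s%:R%:E < T w)%E] `\` [set w | (s.+1%:R%:E < T w)%E].
  apply/seteqP; split=> w; rewrite /level /=.
    by move=> ->; rewrite !lte_fin !ltr_nat ltnn ltnSn; split.
  case: (T_nat w) => [->|[u ->]]; first by rewrite !ltry => -[].
  rewrite !lte_fin !ltr_nat => -[su /negP]; rewrite -leqNgt => us.
  by congr (_%:R%:E); apply/eqP; rewrite eqn_leq us.
have sub : [set w | (s.+1%:R%:E < T w)%E] `<=` [set w | (s%:R%:E < T w)%E].
  by move=> w /=; apply: lt_trans; rewrite lte_fin ltr_nat.
rewrite measureD; [|exact: measurable_tail|exact: measurable_tail|]; last first.
  by rewrite ltey_eq fin_num_measure //; exact: measurable_tail.
rewrite (setIidr sub); exact: (congr2 (fun x y => (x - y)%E) (tailE P T_meas _) (tailE P T_meas _)).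
Qed.

Lemma cvg_tail_level0 : (tail P T s)%:E @[s --> \oo] --> P (level T 0).
Proof.
have -> : level T 0 = \bigcap_s [set w | (s%:R%:E < T w)%E].
  apply/seteqP; split=> w; rewrite /level /=; first by move=> h s _ /=; rewrite h ltry.
  by case: (T_nat w) => [//|[t Tw] /(_ t I)]; rewrite /= Tw ltxx.
rewrite (_ : (fun s => (tail P T s)%:E) = P \o (fun s => [set w | (s%:R%:E < T w)%E])).
  apply: nonincreasing_cvg_mu.
  - by rewrite ltey_eq fin_num_measure //; exact: measurable_tail.
  - by move=> s; exact: measurable_tail.
  - by apply: bigcapT_measurable => s; exact: measurable_tail.
  - move=> s t st; apply/subsetPset => w /=.
    by apply: le_lt_trans; rewrite lee_fin ler_nat.
by apply/funext => s /=; rewrite tailE.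
Qed.

Lemma level_bigcup : \bigcup_i level T i = setT.
Proof. by apply/seteqP; split=> // w _; have [i h] := level_cover T_nat w; exists i. Qed.

Lemma level_trivIset : trivIset setT (level T).
Proof. by move=> i j _ _ [w [hi hj]]; exact: level_inj hi hj. Qed.

End LevelLaw.

(** Finite levels have mass given by differences of tails, and the level of [+oo] by their limit. *)
Lemma level_law_eq (R : realType) d d' (Omega : measurableType d)
  (Omega' : measurableType d') (P : probability Omega R) (P' : probability Omega' R)
  (T : Omega -> \bar R) (T' : Omega' -> \bar R) :
  (forall w, T w = +oo%E \/ exists t : nat, T w = t%:R%:E) ->
  (forall w, T' w = +oo%E \/ exists t : nat, T' w = t%:R%:E) ->
  (forall t : nat, measurable [set w | (T w <= t%:R%:E)%E]) ->
  (forall t : nat, measurable [set w | (T' w <= t%:R%:E)%E]) ->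
  tail P T =1 tail P' T' -> forall i, P (level T i) = P' (level T' i).
Proof.
move=> Tn Tn' Tm Tm' h [|t]; last by rewrite !prob_levelS // h; case: t => // s; rewrite h.
have c := @cvg_tail_level0 _ _ _ P _ Tn Tm.
have c' := @cvg_tail_level0 _ _ _ P' _ Tn' Tm'.
apply: (cvg_unique _ c) => //.
by rewrite (_ : (fun s => _) = (fun s => (tail P' T' s)%:E)) //; apply/funext => s; rewrite h.
Qed.

Section Quantile.
Variable R : realType.
Local Notation U01 := (uniform_prob (@ltr01 R)).

Lemma uniform_prob_le (c : R) : 0 <= c <= 1 -> U01 [set u | u <= c] = c%:E.
Proof.
move=> /andP[c0 c1]; rewrite /uniform_prob integral_uniform_pdf.
have -> : [set u | u <= c] `&` `[0, 1]%classic = `[0, c]%classic.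
  apply/seteqP; split=> u; rewrite /= !in_itv /=; first by case=> -> /andP[->].
  by move=> /andP[-> uc]; rewrite uc (le_trans uc).
rewrite (eq_integral (fun=> 1%E)); last first.
  move=> x; rewrite inE /= in_itv /= /uniform_pdf => /andP[x0 xc].
  by rewrite x0 (le_trans xc c1) /= subr0 invr1.
rewrite integral_cst //= mul1e lebesgue_measure_itv /= lte_fin.
have [c0'|c0'] := ltP 0 c; first by rewrite oppr0 adde0.
by congr EFin; apply/eqP; rewrite eq_le c0 c0'.
Qed.

Variable a : nat -> R.
Hypothesis a_anti : {homo a : s t / (s <= t)%N >-> t <= s}.
Hypothesis a01 : forall s, 0 <= a s <= 1.

(** Generalized inverse of the tail [a]: evaluated at a uniform variable it has tail [a]. It is
    nonincreasing in [u]. *)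
Definition quantile (u : measurableTypeR R) : \bar R :=
  if first_time (fun t => a t < u) is Some t then t%:R%:E else +oo%E.

Lemma quantile_nat u : quantile u = +oo%E \/ exists t : nat, quantile u = t%:R%:E.
Proof. by rewrite /quantile; case: first_time => [t|]; [right; exists t|left]. Qed.

Lemma quantile_le u t : (quantile u <= t%:R%:E)%E = (a t < u).
Proof.
rewrite /quantile; case e: first_time => [s|]; last first.
  by rewrite leye_eq; apply/esym/negbTE; exact: (first_time_None t e).
have /first_timeP[as_ hs] := e; rewrite lee_fin ler_nat.
apply/idP/idP => [st|]; first by apply: le_lt_trans as_; exact: a_anti.
by apply: contraTT; rewrite -ltnNge => /hs.
Qed.

Lemma measurable_quantile (t : nat) : measurable [set u | (quantile u <= t%:R%:E)%E].
Proof.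
have -> : [set u | (quantile u <= t%:R%:E)%E] = `]a t, +oo[%classic.
  by apply/seteqP; split=> u /=; rewrite quantile_le in_itv /= andbT.
exact: measurable_itv.
Qed.

Lemma tail_quantile : tail U01 quantile =1 a.
Proof.
move=> s; rewrite /tail (_ : [set u | _] = [set u | u <= a s]).
  exact: (congr1 fine (uniform_prob_le (a01 s))).
by apply/seteqP; split=> u /=; rewrite ltNge quantile_le -leNgt.
Qed.

End Quantile.

Lemma uniform_prob_oc (R : realType) (c c' : R) : 0 <= c <= 1 -> 0 <= c' <= 1 ->
  (uniform_prob (@ltr01 R) [set u | (c < u <= c')%R] <= (Num.max 0 (c' - c))%:E)%E.
Proof.
move=> h h'; have m x : measurable [set u : R | u <= x].
  have -> : [set u : R | u <= x] = `]-oo, x]%classic.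
    by apply/seteqP; split=> u /=; rewrite in_itv.
  exact: measurable_itv.
have [cc|cc] := leP c c'; last first.
  rewrite (_ : [set u | _] = set0) ?measure0 ?lee_fin ?le_max ?lexx //.
  apply/seteqP; split=> u //= /andP[cu uc].
  by have := lt_trans cc (lt_le_trans cu uc); rewrite ltxx.
have -> : [set u | c < u <= c'] = [set u | u <= c'] `\` [set u | u <= c].
  by apply/seteqP; split=> u /=; [move=> /andP[cu ->]; split=> //; apply/negP; rewrite -ltNge
    |move=> [-> /negP]; rewrite -ltNge => ->].
have sub : [set u | u <= c] `<=` [set u | u <= c'] by move=> u /= /le_trans; exact.
rewrite measureD; [|exact: m|exact: m|by rewrite ltey_eq fin_num_measure //; exact: m].
rewrite (setIidr sub).
rewrite [X in (X <= _)%E](congr2 (fun x y => (x - y)%E) (uniform_prob_le h') (uniform_prob_le h)).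
by rewrite -EFinB lee_fin le_max lexx orbT.
Qed.

Section QuantileCoupling.
Variables (R : realType) (d d' : measure_display).
Variables (Omega : measurableType d) (Omega' : measurableType d').
Variables (P : probability Omega R) (P' : probability Omega' R).
Variables (T : Omega -> \bar R) (T' : Omega' -> \bar R).
Hypothesis Tn : forall w, T w = +oo%E \/ exists t : nat, T w = t%:R%:E.
Hypothesis Tn' : forall w, T' w = +oo%E \/ exists t : nat, T' w = t%:R%:E.
Hypothesis Tm : forall t : nat, measurable [set w | (T w <= t%:R%:E)%E].
Hypothesis Tm' : forall t : nat, measurable [set w | (T' w <= t%:R%:E)%E].
Local Notation U01 := (uniform_prob (@ltr01 R)).
Local Notation a := (tail P T).
Local Notation b := (tail P' T').

Definition transports d0 (Omega0 : measurableType d0) (Q : probability Omega0 R)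
    d1 (Omega1 : measurableType d1) (f : Omega0 -> Omega1) (P1 : set Omega1 -> \bar R) :=
  forall A, measurable A -> measurable (f @^-1` A) /\ Q (f @^-1` A) = P1 A.

(** Two gluings along levels: [T] with [quantile a] of a uniform variable, then [quantile b] of the
    same variable with [T']. The whole spaces are coupled, so the walks themselves survive. *)
Lemma quantile_coupling : exists d0 (Omega0 : measurableType d0)
  (Q : probability Omega0 R) (f : Omega0 -> Omega) (g : Omega0 -> Omega')
  (U : Omega0 -> measurableTypeR R) (N : set Omega0),
  [/\ transports Q f P, transports Q g P', transports Q U U01, measurable N /\ Q N = 1%E &
    forall w, N w -> T (f w) = quantile a (U w) /\ T' (g w) = quantile b (U w)].
Proof.
have aa := tail_anti P Tm; have a01 := tail_bound P Tm.
have ba := tail_anti P' Tm'; have b01 := tail_bound P' Tm'.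
have mqa := measurable_quantile aa; have mqb := measurable_quantile ba.
have [Q1 [Q1f Q1s Q1d]] := glue_exists (measurable_level Tn Tm)
  (measurable_level (quantile_nat a) mqa) (level_bigcup Tn) (level_bigcup (quantile_nat a))
  (level_trivIset (T := T)) (level_trivIset (T := quantile a))
  (level_law_eq Tn (quantile_nat a) Tm mqa (fun s => esym (tail_quantile aa a01 s))).
pose T1 (p : Omega * measurableTypeR R) := quantile b p.2.
have T1n p : T1 p = +oo%E \/ exists t : nat, T1 p = t%:R%:E by exact: quantile_nat.
have msnd1 (A : set (measurableTypeR R)) : measurable A ->
    measurable (snd @^-1` A : set (Omega * measurableTypeR R)).
  by move=> mA; rewrite -[X in measurable X]setTI; exact: measurable_snd.
have m1 t : measurable [set p | (T1 p <= t%:R%:E)%E] by exact: (msnd1 _ (mqb t)).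
have lawE i : Q1 (level T1 i) = P' (level T' i).
  rewrite -(level_law_eq (quantile_nat b) Tn' mqb Tm' (tail_quantile ba b01) i).
  by rewrite -Q1s //; exact: measurable_level (quantile_nat b) mqb i.
have [Q [Qf Qs Qd]] := glue_exists (measurable_level T1n m1)
  (measurable_level Tn' Tm') (level_bigcup T1n) (level_bigcup Tn')
  (level_trivIset (T := T1)) (level_trivIset (T := T')) lawE.
pose f (p : (Omega * measurableTypeR R) * Omega') := p.1.1.
pose U (p : (Omega * measurableTypeR R) * Omega') := p.1.2.
pose D1 := \bigcup_i (level T i `*` level (quantile a) i).
pose D2 := \bigcup_i (level T1 i `*` level T' i).
have mD1 : measurable D1.
  apply: bigcup_measurable => i _; apply: measurableX; first exact: measurable_level.
  exact: measurable_level (quantile_nat a) mqa i.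
have mD2 : measurable D2.
  by apply: bigcup_measurable => i _; apply: measurableX; exact: measurable_level.
have mfst (A : set (Omega * measurableTypeR R)) : measurable A ->
    measurable (fst @^-1` A : set ((Omega * measurableTypeR R) * Omega')).
  by move=> mA; rewrite -[X in measurable X]setTI; exact: measurable_fst.
have mfst1 (A : set Omega) : measurable A ->
    measurable (fst @^-1` A : set (Omega * measurableTypeR R)).
  by move=> mA; rewrite -[X in measurable X]setTI; exact: measurable_fst.
have msnd (A : set Omega') : measurable A ->
    measurable (snd @^-1` A : set ((Omega * measurableTypeR R) * Omega')).
  by move=> mA; rewrite -[X in measurable X]setTI; exact: measurable_snd.
exists _, _, Q, f, snd, U, (fst @^-1` D1 `&` D2); split.
- move=> A mA; split; first exact: (mfst _ (mfst1 _ mA)).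
  by rewrite -Q1f // -Qf //; exact: mfst1.
- by move=> A mA; split; [exact: msnd|exact: Qs].
- move=> A mA; split; first exact: (mfst _ (msnd1 _ mA)).
  by rewrite -Q1s // -Qf //; exact: msnd1.
- have mN := measurableI _ _ (mfst _ mD1) mD2; split=> //.
  have z1 : Q (~` (fst @^-1` D1)) = 0%E.
    by rewrite probability_setC ?Qf ?Q1d ?subee //; exact: mfst.
  have z2 : Q (~` D2) = 0%E by rewrite probability_setC ?Qd ?subee.
  have : (Q (~` (fst @^-1` D1) `|` ~` D2) <= Q (~` (fst @^-1` D1)) + Q (~` D2))%E.
    by apply: measureU2; apply: measurableC => //; exact: mfst.
  rewrite z1 z2 adde0 -setCI probability_setC // => h.
  apply/eqP; rewrite eq_le probability_le1 //=.
  have fin : Q (fst @^-1` D1 `&` D2) \is a fin_num by rewrite fin_num_measure.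
  by rewrite -sube_le0.
- move=> [[w u] w'] [[i _ [/= h1 h2]] [j _ [/= h3 h4]]].
  by split; [exact: etrans h1 (esym h2)|exact: etrans h4 (esym h3)].
Qed.

End QuantileCoupling.

Section CouplingEvent.
Variable R : realType.

(** Deterministic part: rounding [T] and [T'] up to multiples of the block lengths pins their ratio
    near 2. *)
Lemma double_ratio (T T' : \bar R) m J :
  (T = +oo%E \/ exists t : nat, T = t%:R%:E) ->
  (T' = +oo%E \/ exists t : nat, T' = t%:R%:E) ->
  (1 < m)%N -> (2 * m * m.+1 <= J)%N ->
  ((2 * m * m.+1 * J)%:R%:E <= T)%E ->
  (forall j, (J <= j)%N -> (T <= (m * j)%:R%:E)%E -> (T' <= (2 * m.+1 * j)%:R%:E)%E) ->
  (forall j, (J <= j)%N -> (T' <= (2 * m * j)%:R%:E)%E -> (T <= (m.+1 * j)%:R%:E)%E) ->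
  exists2 r : R, `|r| <= 2 / m%:R & T' = ((2 * (1 + r))%:E * T)%E.
Proof.
move=> hT hT' m1; have m0 : (0 < m)%N by exact: ltnW.
case: hT => [->|[t ->]] MJ TJ h1 h2.
  (* If [T] is infinite so is [T']: a finite value [u] would let [h2] at [maxn J u] bound [T]. *)
  exists 0; first by rewrite normr0 divr_ge0.
  rewrite addr0 mulr1 gt0_muley ?lte_fin //.
  case: hT' h2 => [//|[u ->]] h2.
  have := h2 (maxn J u) (leq_maxl _ _); rewrite lee_fin ler_nat.
  have hu : (u <= 2 * m * maxn J u)%N.
    apply: leq_trans (leq_maxr J u) _; by rewrite leq_pmull // muln_gt0.
  by move=> /(_ hu); rewrite leye_eq.
rewrite lee_fin ler_nat in TJ.
have J0 : (0 < J)%N by apply: leq_trans MJ; rewrite !muln_gt0 m0.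
have tm := divn_eq t m; have tm' := ltn_pmod t m0.
(* [m * (t %/ m).+1] is the first multiple of [m] beyond [t], at distance at most [m]. *)
have := h1 (t %/ m).+1; rewrite !lee_fin !ler_nat => /(_ _ _).
have e1 : (J <= (t %/ m).+1)%N.
  by rewrite leqW // leq_divRL //; apply: leq_trans TJ; rewrite mulnC leq_mul2r; nia.
have e2 : (t <= m * (t %/ m).+1)%N by rewrite mulnC mulSn {1}tm addnC leq_add2r ltnW.
move=> /(_ e1 e2); case: hT' h2 => [->|[u ->]] h2; first by rewrite leye_eq.
rewrite lee_fin ler_nat => up.
have lo : (t * (2 * m) <= m.+1 * (u + 2 * m))%N.
  (* A small [u] is impossible: [h2] at [J] would give [t <= m.+1 * J], against the lower bound
     [TJ]. *)
  have [uJ|Ju] := leqP u (2 * m * J).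
    have := h2 J (leqnn _); rewrite !lee_fin !ler_nat => /(_ uJ) tJ.
    exfalso; move: (leq_trans TJ tJ); rewrite leq_pmul2r //; nia.
  have m20 : (0 < 2 * m)%N by rewrite muln_gt0.
  have um := divn_eq u (2 * m); have um' := ltn_pmod u m20.
  have := h2 (u %/ (2 * m)).+1; rewrite !lee_fin !ler_nat => /(_ _ _).
  have f1 : (J <= (u %/ (2 * m)).+1)%N by rewrite leqW // leq_divRL // mulnC ltnW.
  have f2 : (u <= 2 * m * (u %/ (2 * m)).+1)%N.
    by rewrite mulnC mulSn {1}um addnC leq_add2r ltnW.
  move=> /(_ f1 f2) tu.
  apply: leq_trans (_ : m.+1 * (u %/ (2 * m)).+1 * (2 * m) <= _)%N.
    by rewrite leq_mul2r tu orbT.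
  rewrite -mulnA leq_mul2l (mulSn (u %/ (2 * m))) addnC leq_add2r.
  by rewrite [X in (_ <= X)%N]um leq_addr orbT.
have up' : (u * m <= 2 * m.+1 * (t + m))%N.
  apply: leq_trans (_ : 2 * m.+1 * (t %/ m).+1 * m <= _)%N.
    by rewrite leq_mul2r up orbT.
  rewrite -mulnA leq_mul2l (mulSn (t %/ m)) addnC leq_add2r.
  by rewrite [X in (_ <= X)%N]tm leq_addr orbT.
have tM : (2 * m * m.+1 <= t)%N by apply: leq_trans TJ; exact: leq_pmulr.
have mR : 1 < m%:R :> R by rewrite (ltr_nat _ 1).
move: up' lo tM; rewrite -!(ler_nat R) !(natrM, natrD) -![m.+1%:R]natr1.
move: (t%:R : R) (u%:R : R) (m%:R : R) mR => x y c c1 up' lo tM.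
have x0 : 0 < x by apply: lt_le_trans tM; rewrite !mulr_gt0 //; lra.
exists (y / (2 * x) - 1); last by congr EFin; field; rewrite gt_eqF.
have c0 : 0 < c by lra.
have x2 : 0 < 2 * x by rewrite mulr_gt0.
rewrite (_ : y / (2 * x) - 1 = (y - 2 * x) / (2 * x)); last by field; rewrite gt_eqF.
rewrite normrM normfV (gtr0_norm x2) ler_pdivrMr // mulrAC ler_pdivlMr //.
have [yx|yx] := leP 0 (y - 2 * x); [rewrite ger0_norm //|rewrite ltr0_norm //].
  by nra.
by nra.
Qed.

(** The ratio can fail only on a null set, where [T] is below the threshold (probability at most
    [e]), or where the uniform variable falls between compared tails (at most [2 * e]). *)
Lemma coupling_event d d' (Omega : measurableType d) (Omega' : measurableType d')
    (P : probability Omega R) (P' : probability Omega' R)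
    (T : Omega -> \bar R) (T' : Omega' -> \bar R) :
  (forall w, T w = +oo%E \/ exists t : nat, T w = t%:R%:E) ->
  (forall w, T' w = +oo%E \/ exists t : nat, T' w = t%:R%:E) ->
  (forall t : nat, measurable [set w | (T w <= t%:R%:E)%E]) ->
  (forall t : nat, measurable [set w | (T' w <= t%:R%:E)%E]) ->
  exists d0 (Omega0 : measurableType d0) (Q : probability Omega0 R)
    (f : Omega0 -> Omega) (g : Omega0 -> Omega'),
  [/\ transports Q f P, transports Q g P' &
    forall (m J : nat) (q c e r0 : R), (1 < m)%N -> 2 / m%:R <= r0 ->
      (2 * m * m.+1 <= J)%N -> 0 < q -> q < 1 ->
      0 <= c -> c * q ^+ J / (1 - q) <= e ->
      (forall s, (s < 2 * m * m.+1 * J)%N -> 1 - e <= tail P T s) ->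
      (forall j, tail P' T' (2 * m.+1 * j) <= tail P T (m * j) + c * q ^+ j /\
                 tail P T (m.+1 * j) <= tail P' T' (2 * m * j) + c * q ^+ j) ->
      ((1 - 3 * e)%:E <= Q [set w | exists2 r : R, (`|r| <= r0)%R &
         T' (g w) = ((2 * (1 + r))%:E * T (f w))%E])%E].
Proof.
move=> Tn Tn' Tm Tm'.
have [d0 [Om0 [Q [f [g [U [N [Qf Qg QU [mN QN] hN]]]]]]]] :=
  quantile_coupling P P' Tn Tn' Tm Tm'.
exists d0, Om0, Q, f, g; split=> // m J q c e r0 m1 mr0 MJ q0 q1 c0 ce ha hab.
set a := tail P T in hN ha hab *; set b := tail P' T' in hN hab *.
have aa : {homo a : s t / (s <= t)%N >-> t <= s} := tail_anti P Tm.
have ba : {homo b : s t / (s <= t)%N >-> t <= s} := tail_anti P' Tm'.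
have a01 : forall s, 0 <= a s <= 1 := tail_bound P Tm.
have b01 : forall s, 0 <= b s <= 1 := tail_bound P' Tm'.
set Good := [set w | _].
(* [Good] depends only on the values of [T] and [T'], hence is a countable union of intersections of
   levels. *)
have mGood : measurable Good.
  have -> : Good = \bigcup_i \bigcup_(j in [set j | exists w0, [/\ Good w0,
      level T i (f w0) & level T' j (g w0)]]) (f @^-1` level T i `&` g @^-1` level T' j).
    apply/seteqP; split=> w.
      move=> Gw; have [i fi] := level_cover Tn (f w); have [j gj] := level_cover Tn' (g w).
      by exists i => //; exists j => //; exists w.
    move=> [i _ [j [w0 [[r hr hw] fi gj]] [fi' gj']]].
    exists r => //; move: fi gj fi' gj' hw; rewrite /level /preimage /= => -> -> -> ->.
    by [].
  apply: bigcup_measurable => i _; apply: bigcup_measurable => j _.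
  apply: measurableI; [apply: (Qf _ _).1|apply: (Qg _ _).1]; exact: measurable_level.
have m0 : (0 < m)%N by exact: ltnW.
have J0 : (0 < J)%N by apply: leq_trans MJ; rewrite !muln_gt0 m0.
pose s := (2 * m * m.+1 * J).-1.
have sE : s.+1 = (2 * m * m.+1 * J)%N by rewrite prednK // !muln_gt0 m0.
pose L := f @^-1` [set w | (T w <= s%:R%:E)%E].
have mL : measurable L by apply: (Qf _ _).1.
have QL : (Q L <= e%:E)%E.
  rewrite (Qf _ (Tm s)).2 (prob_leE P Tm) lee_fin.
  by have := ha s; rewrite -sE ltnSn -/a => /(_ isT); lra.
have mI (x y : R) : measurable ([set u | x < u <= y] : set (measurableTypeR R)).
  have -> : [set u | x < u <= y] = `]x, y]%classic.
    by apply/seteqP; split=> u /=; rewrite in_itv.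
  exact: measurable_itv.
(* Up to a null set, [B1 j] says that [T <= m * j] while [T' > 2 * m.+1 * j], and [B2 j] that
   [T' <= 2 * m * j] while [T > m.+1 * j]. *)
pose B1 j := U @^-1` [set u | a (m * j)%N < u <= b (2 * m.+1 * j)%N].
pose B2 j := U @^-1` [set u | b (2 * m * j)%N < u <= a (m.+1 * j)%N].
pose B j := if (J <= j)%N then B1 j `|` B2 j else set0.
have mB1 j : measurable (B1 j) by apply: (QU _ _).1; exact: mI.
have mB2 j : measurable (B2 j) by apply: (QU _ _).1; exact: mI.
have mB j : measurable (B j) by rewrite /B; case: ifP => // _; exact: measurableU.
have QB j : (Q (B j) <= (2 * c * ((J <= j)%N%:R * q ^+ j))%:E)%E.
  rewrite /B; case: ifP => _; last by rewrite measure0 mul0r mulr0.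
  apply: le_trans (measureU2 _ (mB1 j) (mB2 j)) _.
  have cq : 0 <= c * q ^+ j by rewrite mulr_ge0 // exprn_ge0 // ltW.
  rewrite mul1r -mulrA mulr_natl mulr2n EFinD; apply: leeD.
    apply: (@le_trans _ _ (uniform_prob (@ltr01 R)
        [set u | a (m * j)%N < u <= b (2 * m.+1 * j)%N])).
      by rewrite -(QU _ (mI _ _)).2.
    apply: le_trans (uniform_prob_oc (a01 _) (b01 _)) _.
    by rewrite lee_fin ge_max cq; have := (hab j).1; lra.
  apply: (@le_trans _ _ (uniform_prob (@ltr01 R)
      [set u | b (2 * m * j)%N < u <= a (m.+1 * j)%N])).
    by rewrite -(QU _ (mI _ _)).2.
  apply: le_trans (uniform_prob_oc (b01 _) (a01 _)) _.
  by rewrite lee_fin ge_max cq; have := (hab j).2; lra.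
pose BB := \bigcup_j B j.
have mBB : measurable BB by apply: bigcup_measurable.
have QBB : (Q BB <= (2 * e)%:E)%E.
  apply: le_trans (generalized_Boole_inequality _ mB mBB) _.
  apply: lime_le; first by apply: is_cvg_nneseries => *; exact: measure_ge0.
  apply: nearW => M; apply: le_trans (lee_sum _ (fun j _ => QB j)) _.
  rewrite sumEFin lee_fin -mulr_sumr.
  have := sum_geometric_tail_le J M q0 q1.
  have : c * (q ^+ J / (1 - q)) <= e by rewrite mulrA.
  move=> h1 h2; have := ler_wpM2l c0 h2; lra.
have sub : N `&` ~` L `&` ~` BB `<=` Good.
  move=> w [[Nw Lw] Bw]; have [Tq Tq'] := hN w Nw.
  suff [r hr er] : exists2 r : R, `|r| <= 2 / m%:R &
      T' (g w) = ((2 * (1 + r))%:E * T (f w))%E by exists r => //; exact: le_trans mr0.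
  apply: (@double_ratio _ _ m J) => //.
  - move: Lw; rewrite /L /preimage /= => /negP; rewrite -ltNge -sE.
    case: (Tn (f w)) => [->|[t ->]]; first by rewrite leey.
    by rewrite lte_fin lee_fin ltr_nat ler_nat.
  - move=> j Jj; rewrite Tq Tq' !quantile_le // => au; rewrite ltNge; apply/negP => ub.
    by apply: Bw; exists j => //; rewrite /B Jj; left; rewrite /B1 /preimage /= au.
  - move=> j Jj; rewrite Tq Tq' !quantile_le // => bu; rewrite ltNge; apply/negP => ua.
    by apply: Bw; exists j => //; rewrite /B Jj; right; rewrite /B2 /preimage /= bu.
have subC : ~` Good `<=` ~` N `|` L `|` BB.
  move=> w Gw; have [Nw|Nw] := pselect (N w); last by left; left.
  have [Lw|Lw] := pselect (L w); first by left; right.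
  have [Bw|Bw] := pselect (BB w); first by right.
  by case: Gw; apply: sub.
have QNC : Q (~` N) = 0%E by rewrite probability_setC // QN subee.
have mNC := measurableC mN.
have h : (Q (~` Good) <= (3 * e)%:E)%E.
  apply: (@le_trans _ _ (Q (~` N `|` L `|` BB))).
    apply: le_measure; rewrite ?inE //; first exact: measurableC.
    by apply: measurableU => //; exact: measurableU.
  apply: (@le_trans _ _ (Q (~` N `|` L) + Q BB)%E).
    by apply: measureU2 => //; exact: measurableU.
  apply: (@le_trans _ _ (e%:E + (2 * e)%:E)%E); last by rewrite -EFinD lee_fin; lra.
  apply: leeD => //; apply: (@le_trans _ _ (Q (~` N) + Q L)%E); first exact: measureU2.
  by rewrite QNC add0e.
have fin : Q Good \is a fin_num by rewrite fin_num_measure.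
move: h; rewrite probability_setC // -(fineK fin) -EFinB !lee_fin; lra.
Qed.

Lemma indep_walks_transport d0 d (V : finType) (K : V -> V -> R) (v : V)
    (Omega0 : measurableType d0) (Omega : measurableType d) (Q : probability Omega0 R)
    (P : probability Omega R) (f : Omega0 -> Omega) X :
  transports Q f P -> indep_walks K v P X -> indep_walks K v Q (X \o f).
Proof.
move=> Qf [mX hX]; split=> [i t x|t x]; first by have [] := Qf _ (mX i t x).
rewrite -hX; have mC : measurable [set w | forall i s, (s <= t)%N -> X w i s = x i s].
  exact: measurable_cylinder (conj mX hX) (fun=> t) x.
exact: (Qf _ mC).2.
Qed.

(** For each [k] take the largest [m <= k] for which the error [1 / m.+1] is good; [m = 0] always
    qualifies by [good1]. *)
Lemma diagonal_rate (good : nat -> R -> Prop) : (forall k, good k 1) ->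
  (forall e, 0 < e -> \forall k \near \oo, good k e) ->
  exists2 eps : R^nat, eps @ \oo --> (0 : R) & forall k, good k (eps k).
Proof.
move=> good1 hgood.
pose p k m := (m <= k)%N && `[< good k m.+1%:R^-1 >].
have p0 k : exists m, p k m.
  by exists 0%N; rewrite /p leq0n /=; apply/asboolP; rewrite invr1.
have pb k m : p k m -> (m <= k)%N by case/andP.
exists (fun k => (ex_maxn (p0 k) (@pb k)).+1%:R^-1); last first.
  by move=> k; case: ex_maxnP => m /andP[_ /asboolP].
apply/cvgrPdist_le => e e0; pose m := Num.truncn e^-1.
have me : m.+1%:R^-1 <= e.
  by rewrite invf_ple ?posrE //; apply: ltW; exact: truncnS_gt.
have m0 : 0 < m.+1%:R^-1 :> R by rewrite invr_gt0.
apply: filterS2 (hgood _ m0) (nbhs_infty_ge m) => k gk mk.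
rewrite sub0r normrN ger0_norm ?invr_ge0 //.
case: ex_maxnP => m' _ hm'; apply: le_trans me.
rewrite lef_pV2 ?posrE // ler_nat ltnS; apply: hm'.
by rewrite /p [(m <= k)%N]mk; apply/asboolP.
Qed.


End CouplingEvent.

Lemma coupled_double_of_comparable (R : realType) (tau : dispersion_time R)
  (G : nat -> cgraph) (v : forall k, G k) (alpha beta : R)
  (d : nat -> measure_display) (Omega : forall k, measurableType (d k))
  (P : forall k, probability (Omega k) R)
  (X : forall k, Omega k -> 'I_#|G k| -> nat -> G k)
  (d' : nat -> measure_display) (Omega' : forall k, measurableType (d' k))
  (P' : forall k, probability (Omega' k) R)
  (Y : forall k, Omega' k -> 'I_#|G k| -> nat -> G k) :
  lazy_comparable tau -> 0 < alpha -> 0 < beta ->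
  (fun k => #|G k|) @ \oo --> \oo ->
  (forall k, indep_walks (@srw R (G k)) (v k) (P k) (X k)) ->
  (forall k, indep_walks (@lazy_rw R (G k)) (v k) (P' k) (Y k)) ->
  large_whp tau alpha beta P X -> coupled_double tau v.
Proof.
move=> H alpha0 beta0 Goo hX hY hlarge.
pose good k e := exists (d : measure_display) (Omega : measurableType d)
  (P : probability Omega R) (X Y : Omega -> 'I_#|G k| -> nat -> G k),
  [/\ indep_walks (@srw R (G k)) (v k) P X,
      indep_walks (@lazy_rw R (G k)) (v k) P Y &
      ((1 - e)%:E <= P [set w | exists2 r : R, (`|r| <= e)%R &
         tau (G k) (Y w) = (2 * (1 + r))%:E * tau (G k) (X w)])%E].
suff [eps eps0 heps] : exists2 eps : R^nat, eps @ \oo --> (0 : R) &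
    forall k, good k (eps k) by exists eps, eps; split.
have TXn k w := lc_nat H (X k w); have TYn k w := lc_nat H (Y k w).
have TXm k t := lc_measurable H t (hX k); have TYm k t := lc_measurable H t (hY k).
(* For error 1 the required probability is 0, so any coupling will do. *)
apply: diagonal_rate => [k|e e0].
  have [d0 [Om0 [Q [f [g [Qf Qg _]]]]]] := coupling_event (P k) (P' k)
    (TXn k) (TYn k) (TXm k) (TYm k).
  exists d0, Om0, Q, (X k \o f), (Y k \o g).
  split; [exact: indep_walks_transport Qf (hX k)|exact: indep_walks_transport Qg (hY k)|].
  by rewrite subrr measure_ge0.
pose m := (Num.truncn (2 / e)).+2.
have me : 2 / m%:R <= e.
  rewrite ler_pdivrMr ?ltr0n // mulrC -ler_pdivrMr // ltW //.
  by apply: lt_trans (truncnS_gt _) _; rewrite ltr_nat.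
have M0 : (0 < 2 * m * m.+1)%N by [].
(* [coupling_event] loses three times the error fed to it. *)
have e3 : 0 < e / 3 by rewrite divr_gt0.
apply: filterS (near_tail_compare H alpha0 beta0 Goo hX hY hlarge (m := m) isT M0 e3).
move=> k [q [J [/andP[q0 q1] MJ nq ha hab]]].
have [d0 [Om0 [Q [f [g [Qf Qg hQ]]]]]] := coupling_event (P k) (P' k)
  (TXn k) (TYn k) (TXm k) (TYm k).
exists d0, Om0, Q, (X k \o f), (Y k \o g).
split; [exact: indep_walks_transport Qf (hX k)|exact: indep_walks_transport Qg (hY k)|].
have := hQ m J q _ _ e isT me MJ q0 q1 (ler0n _ _) nq ha hab.
by rewrite (_ : 3 * (e / 3) = e); last by field.
Qed.

Theorem theorem4p3 (R : realType) (G : nat -> cgraph) (v : forall k, G k)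
  (alpha beta : R)
  (d : nat -> measure_display) (Omega : forall k, measurableType (d k))
  (P : forall k, probability (Omega k) R)
  (X : forall k, Omega k -> 'I_#|G k| -> nat -> G k)
  (d' : nat -> measure_display) (Omega' : forall k, measurableType (d' k))
  (P' : forall k, probability (Omega' k) R)
  (Y : forall k, Omega' k -> 'I_#|G k| -> nat -> G k) :
  0 < alpha -> 0 < beta ->
  (fun k => #|G k|) @ \oo --> \oo ->
  (forall k, indep_walks (@srw R (G k)) (v k) (P k) (X k)) ->
  (forall k, indep_walks (@lazy_rw R (G k)) (v k) (P' k) (Y k)) ->
  (large_whp (@tau_seq R) alpha beta P X ->
     coupled_double (@tau_seq R) v /\ mean_double (@tau_seq R) P X P' Y) /\
  (large_whp (@tau_par R) alpha beta P X ->
     coupled_double (@tau_par R) v /\ mean_double (@tau_par R) P X P' Y).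
Proof.
move=> alpha0 beta0 Goo hX hY.
have Hs := lazy_comparable_seq R; have Hp := lazy_comparable_par R.
split=> hlarge; split.
- exact: (coupled_double_of_comparable Hs alpha0 beta0 Goo hX hY hlarge).
- exact: (mean_double_of_comparable Hs alpha0 beta0 Goo hX hY hlarge).
- exact: (coupled_double_of_comparable Hp alpha0 beta0 Goo hX hY hlarge).
- exact: (mean_double_of_comparable Hp alpha0 beta0 Goo hX hY hlarge).
Qed.
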